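(* Let $n\ge 1$, $1<p<r<\infty$, $0<q\le\infty$ and $p'=\frac{p}{p-1}$. There is a constant $c>0$, independent of $f$, such that for every $f\in L_{p,q}(\mathbb R^n)\cap L_1(\mathbb R^n)$ $$\sum_{k\in\mathbb Z}2^{\frac{kq}{p'}}\left(\sum_{m\in D_k}\left(\overline{\widehat f}(2^m;M)\right)^r\right)^{q/r}\le c\,\|f\|^q_{L_{p,q}(\mathbb R^n)},$$ where $$\overline{\widehat f}(2^m;M)=\sup_{Q\in M,\ |Q_j|\ge 2^{m_j},\ j=1,\ldots,n}\frac1{|Q|}\left|\int_Q\widehat f(x)\,dx\right|,\qquad m\in\mathbb Z^n.$$ For $q=\infty$ the inequality is read as $\sup_{k\in\mathbb Z}2^{k/p'}\left(\sum_{m\in D_k}\left(\overline{\widehat f}(2^m;M)\right)^r\right)^{1/r}\le c\,\|f\|_{L_{p,\infty}(\mathbb R^n)}$.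
   Context: The Fourier transform of $f\in L_1(\mathbb R^n)$ is $\widehat f(y)=\int_{\mathbb R^n}f(x)e^{-i(y,x)}\,dx$, where $(y,x)=\sum_{i=1}^n y_ix_i$. For a measurable $f$ on $\mathbb R^n$, with $\mu$ the Lebesgue measure, $f^*(t)=\inf\{\sigma:\ \mu\{x:\ |f(x)|>\sigma\}\le t\}$ is the non-increasing rearrangement. For $0<p<\infty$, $0<q\le\infty$, $L_{p,q}(\mathbb R^n)$ is the Lorentz space of measurable $f$ with $\|f\|_{L_{p,q}}<\infty$, where $\|f\|_{L_{p,q}}=\left(\int_0^\infty (t^{1/p}f^*(t))^q\frac{dt}{t}\right)^{1/q}$ for $q<\infty$ and $\|f\|_{L_{p,\infty}}=\sup_{t>0}t^{1/p}f^*(t)$. For $k\in\mathbb Z$, $D_k=\{m\in\mathbb Z^n:\ m_1+\ldots+m_n=k\}$. $M$ is the set of all parallelepipeds $Q=Q_1\times\ldots\times Q_n$, where the $Q_i$ are (bounded, nondegenerate) segments in $\mathbb R$; $|Q_j|$ is the length of $Q_j$ and $|Q|$ the volume of $Q$. *)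

(* Defs.v *)
From HB Require Import structures.
From mathcomp Require Import all_boot all_order all_algebra.
From mathcomp Require Import complex.
From mathcomp Require Import all_classical all_reals all_analysis.

Set Implicit Arguments.
Unset Strict Implicit.
Unset Printing Implicit Defensive.
Import Order.TTheory GRing.Theory Num.Theory.
Import numFieldNormedType.Exports.

Local Open Scope classical_set_scope.
Local Open Scope ring_scope.

Section lebesgue_measure_Rn.
Context {R : realType}.

Local Notation mR := (measurableTypeR R).

Section cons.
Variables (n : nat) (mu : {sigma_finite_measure set (n.-tuple mR) -> \bar R}).

Definition cons_pair (z : mR * n.-tuple mR) : n.+1.-tuple mR :=
  [tuple of z.1 :: z.2].

Lemma measurable_cons_pair : measurable_fun [set: _] cons_pair.
Proof. exact: measurable_cons. Qed.

Definition cons_measure : set (n.+1.-tuple mR) -> \bar R :=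
  pushforward (@lebesgue_measure R \x mu)%E cons_pair.

Let cons_measure0 : cons_measure set0 = 0%E.
Proof. by rewrite /cons_measure /pushforward preimage_set0 measure0. Qed.

Let cons_measure_ge0 A : (0 <= cons_measure A)%E.
Proof. by rewrite /cons_measure /pushforward measure_ge0. Qed.

Let cons_measure_sigma_additive : semi_sigma_additive cons_measure.
Proof.
move=> F mF tF mUF; rewrite /cons_measure /pushforward preimage_bigcup.
apply: measure_semi_sigma_additive.
- by move=> i; rewrite -[X in measurable X]setTI; exact: measurable_cons_pair.
- apply/trivIsetP => /= i j _ _ ij; rewrite -preimage_setI.
  by move/trivIsetP : tF => /(_ _ _ _ _ ij) ->//; rewrite preimage_set0.
- rewrite -preimage_bigcup -[X in measurable X]setTI.
  exact: measurable_cons_pair.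
Qed.

HB.instance Definition _ := isMeasure.Build _ _ _ cons_measure
  cons_measure0 cons_measure_ge0 cons_measure_sigma_additive.

Let cons_measure_sigma_finite : sigma_finite setT cons_measure.
Proof.
have : sigma_finite setT (@lebesgue_measure R \x mu)%E.
  have /sigma_finiteP[F [TF ndF Foo]] := sigma_finiteT (@lebesgue_measure R).
  have /sigma_finiteP[G [TG ndG Goo]] := sigma_finiteT mu.
  exists (fun k => F k `*` G k).
    rewrite -setXTT TF TG predeqE => -[x y]; split.
      move=> [/= [k _ Fkx] [l _ Gly]]; exists (maxn k l) => //; split.
      - by move: x Fkx; exact/subsetPset/ndF/leq_maxl.
      - by move: y Gly; exact/subsetPset/ndG/leq_maxr.
    by move=> [k _ []/= ? ?]; split; exists k.
  move=> k; have [? ?] := Foo k; have [? ?] := Goo k.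
  split; first exact: measurableX.
  by rewrite product_measure1E// lte_mul_pinfty// ge0_fin_numE.
move=> [F TF Foo].
pose split_tuple (x : n.+1.-tuple mR) : mR * n.-tuple mR :=
  (tnth x ord0, [tuple of behead x]).
have split_tupleK : cancel split_tuple cons_pair.
  by move=> x; rewrite [RHS]tuple_eta; exact: val_inj.
have cons_pairK : cancel cons_pair split_tuple.
  by move=> [x y]; congr pair; exact: val_inj.
exists (fun i => split_tuple @^-1` F i).
  rewrite -preimage_bigcup -TF; exact/esym/preimage_setT.
move=> i; have [mF Fi] := Foo i; split.
  rewrite -[X in measurable X]setTI.
  suff : measurable_fun [set: _] split_tuple by exact.
  apply/measurable_fun_pair; first exact: measurable_tnth.
  exact: measurable_behead.
rewrite /cons_measure /pushforward -comp_preimage.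
by rewrite (_ : split_tuple \o cons_pair = id) ?preimage_id//; exact/funext.
Qed.

HB.instance Definition _ := Measure_isSigmaFinite.Build _ _ _ cons_measure
  cons_measure_sigma_finite.

End cons.

(* The n-fold product of the Lebesgue measure of R, on the Borel sets of R^n. *)
Fixpoint borel_lebesgue n : {sigma_finite_measure set (n.-tuple mR) -> \bar R} :=
  match n with
  | 0 => \d_[tuple] : {sigma_finite_measure set (0.-tuple mR) -> \bar R}
  | n'.+1 => cons_measure (borel_lebesgue n')
  end.

End lebesgue_measure_Rn.

(* R^n with the sigma-algebra of Lebesgue measurable sets, i.e. the Caratheodory
   sets of the outer measure induced by [borel_lebesgue]. *)
Notation Rn R n := (caratheodory_type (mu_ext (@borel_lebesgue R n))).

Definition lebesgue_Rn (R : realType) (n : nat) : {measure set (Rn R n) -> \bar R} :=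
  @completed_measure_extension _ _ _ (borel_lebesgue n).

Section fourier_lorentz.
Context {R : realType} {n : nat}.
Implicit Types (f g : Rn R n -> R[i]) (x y : Rn R n).

Local Notation mu := (lebesgue_Rn R n).

Local Notation cabs := (@Normc.normc R).

Definition cexpi (t : R) : R[i] := Complex (cos t) (sin t).

Definition cmeasurable f :=
  measurable_fun [set: Rn R n] (fun x => complex.Re (f x)) /\
  measurable_fun [set: Rn R n] (fun x => complex.Im (f x)).

Definition cintegral (D : set (Rn R n)) f : R[i] :=
  Complex (\int[mu]_(x in D) complex.Re (f x)) (\int[mu]_(x in D) complex.Im (f x)).

Definition L1 f :=
  cmeasurable f /\ (\int[mu]_x (cabs (f x))%:E < +oo)%E.

Definition dotp y x : R := \sum_(i < n) tnth y i * tnth x i.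

Definition fourier f y : R[i] :=
  cintegral setT (fun x => f x * cexpi (- dotp y x)).

Definition rearrangement f (t : R) : \bar R :=
  ereal_inf [set s%:E | s in
    [set s : R | (mu [set x | (s < cabs (f x))%R] <= t%:E)%E]].

Definition lorentz_norm (p : R) (q : \bar R) f : \bar R :=
  match q with
  | q'%:E => (\int[lebesgue_measure]_(t in `]0%R, +oo[)
      (((t `^ p^-1)%:E * rearrangement f t) `^ q' * (t^-1)%:E)) `^ q'^-1
  | _ => ereal_sup [set (t `^ p^-1)%:E * rearrangement f t
                   | t in [set t : R | (0 < t)%R]]
  end%E.

Definition lorentz (p : R) (q : \bar R) f :=
  cmeasurable f /\ (lorentz_norm p q f < +oo)%E.

(* A parallelepiped is given by its two extreme corners. *)
Definition M : set (n.-tuple R * n.-tuple R) :=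
  [set Q | forall i, tnth Q.1 i < tnth Q.2 i].

Definition box (Q : n.-tuple R * n.-tuple R) : set (Rn R n) :=
  [set x | forall i, tnth Q.1 i <= tnth x i <= tnth Q.2 i].

Definition side (Q : n.-tuple R * n.-tuple R) (i : 'I_n) : R :=
  tnth Q.2 i - tnth Q.1 i.

Definition volume (Q : n.-tuple R * n.-tuple R) : R := \prod_(i < n) side Q i.

Definition box_average g (t : 'I_n -> R) : \bar R :=
  ereal_sup [set ((volume Q)^-1 * cabs (cintegral (box Q) g))%:E
            | Q in [set Q | M Q /\ forall i, t i <= side Q i]].

Definition dyadic (m : n.-tuple int) (i : 'I_n) : R := 2 ^ tnth m i.

Definition Dset (k : int) : set (n.-tuple int) :=
  [set m | \sum_(i < n) tnth m i = k].

End fourier_lorentz.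

(* Main.v *)
Require Import Defs.
From HB Require Import structures.
From mathcomp Require Import all_boot all_order all_algebra.
From mathcomp Require Import complex.
From mathcomp Require Import all_classical all_reals all_analysis.
From mathcomp Require Import measurable_realfun.
From mathcomp Require Import ring lra zify.
Set Implicit Arguments.
Unset Strict Implicit.
Unset Printing Implicit Defensive.
Import Order.TTheory GRing.Theory Num.Theory.
Import numFieldNormedType.Exports.
Local Open Scope classical_set_scope.
Local Open Scope ring_scope.

(** The proof replaces real interpolation by a double dyadic decomposition, so
that everything reduces to sums of geometrically decaying kernels.

By Fubini, the integral of the Fourier transform of f over a box Q is the
integral of f against the transform of the indicator of Q, which has modulus
at most prod_i min(|Q_i|, 2/|x_i|) ([cabs_box_fourier_le]).  Dividing by |Q|
and using |Q_i| >= 2^(m_i), this kernel is at most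
2^n prod_i min(1, 2^(l_i - m_i)) on the shell of the x such that
2^(-l_i) <= |x_i| < 2^(1-l_i) for all i, whatever Q is.

Let v_j be the value at 2^j of the rearrangement of f, E_j the set where
v_(j+1) < |f| <= v_j, and e_jl the measure of the part of E_j in the shell l.
Almost every point with f <> 0 lies in one E_j and one shell, hence the
supremum of the averages is at most
  C sum_(j,l) v_j prod_i min(1, 2^(l_i - m_i)) e_jl
([box_average_le_shells]).  Moreover e_jl <= 2^(j+1), e_jl <= 2^(n - sum_i l_i)
and sum_l e_jl <= 2^(j+1).

The heart of the matter is [decay_mass_le].  Write e = e_jl as
e^(1/r) e^(a-1/r) e^(1-a) with 1/r <= a <= 1, and bound the second factor by
the first estimate and the third by the second one.  For sum_i m_i = k this
produces geometric decay in |m_i - l_i|, for every i, as soon as 0 < a < 1,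
and a factor 2^((j+k)(a-1/p)).  The latter decays geometrically in |j + k| if
a < 1/p when j + k >= 0 and a > 1/p when j + k < 0; both choices of a are
possible because 1 < p < r.  This choice of a is what an interpolation between
two Lebesgue spaces around L_p would do.

The sums are then handled by [esum_wpow]: for any exponent t > 0,
(sum u x)^t <= (sum u)^t sum x^t.  Being valid for t < 1 as well as t > 1, it
spares Minkowski's and Young's inequalities, and makes the cases q < 1 and
q >= 1 identical.  It yields ([weighted_block_sum_le]), for
b_j = 2^(j/p) v_j and some d > 0,
  2^(k r/p') sum_(m in D_k) (average)^r <= C sum_j 2^(-d|k+j|) b_j^r.
Raising this to the power q/r and summing over k leaves sum_j b_j^q, which is
bounded by the q-th power of the Lorentz norm ([esum_height_le]); for
q = oo it suffices that every b_j is at most the norm. *)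

(** * Unordered sums of extended reals *)

Section esum_facts.
Context {R : realType}.
Local Open Scope ereal_scope.

Lemma esum_leZl (T : choiceType) (I : set T) (c : \bar R) (a : T -> \bar R) :
  0 <= c -> (forall i, 0 <= a i) ->
  \esum_(i in I) (c * a i) <= c * \esum_(i in I) a i.
Proof.
move=> c0 a0; apply: ge_ereal_sup => _ [X XI] <-.
rewrite -ge0_mule_fsumr//; apply: lee_wpmul2l => //.
by apply: esum_ge; exists X.
Qed.

Lemma esumZl (T : choiceType) (I : set T) (c : R) (a : T -> \bar R) :
  (0 < c)%R -> (forall i, 0 <= a i) ->
  (c%:E * (\esum_(i in I) a i) = \esum_(i in I) (c%:E * a i))%E.
Proof.
move=> c0 a0; have ce0 : 0 <= c%:E by rewrite lee_fin ltW.
apply/eqP; rewrite eq_le esum_leZl// andbT.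
rewrite -(@lee_pmul2l _ (c^-1)%:E) ?lte_fin ?invr_gt0//.
rewrite muleA -EFinM mulVf ?gt_eqF// mul1e.
apply: le_trans (esum_leZl _ _ _); rewrite ?lee_fin ?invr_ge0 ?(ltW c0)//.
  by apply: le_esum => i _; rewrite muleA -EFinM mulVf ?gt_eqF// mul1e.
by move=> i; rewrite mule_ge0.
Qed.

Lemma esum_ge1 (T : choiceType) (a : T -> \bar R) i :
  (forall i, 0 <= a i) -> a i <= \esum_(i in [set: T]) a i.
Proof.
move=> a0; apply: esum_ge; exists [set i]; last by rewrite fsbig_set1.
by split => //; exact: finite_set1.
Qed.

Lemma esum_subset (T : choiceType) (I J : set T) (a : T -> \bar R) :
  I `<=` J -> \esum_(i in I) a i <= \esum_(i in J) a i.
Proof.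
move=> IJ; apply: ge_ereal_sup => _ [X [fX XI]] <-; apply: esum_ge.
by exists X => //; split => //; exact: subset_trans IJ.
Qed.

Lemma esum_exchange (T U : choiceType) (I : set T) (J : set U)
    (a : T -> U -> \bar R) :
  (forall i j, 0 <= a i j) ->
  \esum_(i in I) \esum_(j in J) a i j = \esum_(j in J) \esum_(i in I) a i j.
Proof.
move=> a0; rewrite !esum_esum//.
rewrite (@reindex_esum _ _ _ (J `*`` (fun=> I)) _ (fun x => (x.2, x.1)))//.
split=> //=.
- by move=> [i j] [/= ? ?]; split.
- by move=> [i j] [i' j'] _ _ /= [-> ->].
- by move=> [i j] [/= ? ?]; exists (j, i).
Qed.

Lemma esum_pair (T U : choiceType) (a : T -> U -> \bar R) :
  (forall i j, 0 <= a i j) ->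
  \esum_(x in [set: T * U]) a x.1 x.2
  = \esum_(i in [set: T]) \esum_(j in [set: U]) a i j.
Proof.
by move=> a0; rewrite esum_esum//; congr esum; apply/seteqP; split.
Qed.

Lemma le_poweR (x y : \bar R) (r : R) :
  (0 <= r)%R -> 0 <= x -> x <= y -> x `^ r <= y `^ r.
Proof.
move=> r0 x0 xy; apply: gt0_ler_poweR => //; rewrite in_itv/= leey andbT//.
exact: le_trans xy.
Qed.

Lemma poweRVK (x : \bar R) (r : R) : (0 < r)%R -> 0 <= x -> (x `^ r^-1) `^ r = x.
Proof. by move=> r0 x0; rewrite -poweRrM mulVf ?gt_eqF// poweRe1. Qed.

Lemma poweRKV (x : \bar R) (r : R) : (0 < r)%R -> 0 <= x -> (x `^ r) `^ r^-1 = x.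
Proof. by move=> r0 x0; rewrite -poweRrM mulfV ?gt_eqF// poweRe1. Qed.

(** Each [x i] is at most [(\esum_i x i `^ r) `^ r^-1], so the weighted sum is
at most this bound times the total weight; no convexity is involved, which is
why every exponent [r > 0] is allowed. *)
Lemma esum_wpow (T : choiceType) (u x : T -> \bar R) (r : R) : (0 < r)%R ->
  (forall i, 0 <= u i) -> (forall i, 0 <= x i) ->
  (\esum_(i in [set: T]) (u i * x i)) `^ r
  <= (\esum_(i in [set: T]) u i) `^ r * \esum_(i in [set: T]) x i `^ r.
Proof.
move=> r0 u0 x0.
set X := \esum_(i in [set: T]) x i `^ r.
have X0 : 0 <= X by apply: esum_ge0 => i _; exact: poweR_ge0.
have xX i : x i <= X `^ r^-1.
  rewrite -[leLHS](poweRKV r0)//; apply: le_poweR => //.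
  - by rewrite invr_ge0 ltW.
  - exact: poweR_ge0.
  - by apply: esum_ge1 => j; exact: poweR_ge0.
rewrite -[X in _ * X](poweRVK r0)// -poweRM ?poweR_ge0 ?esum_ge0//.
apply: le_poweR; first exact: ltW.
  by apply: esum_ge0 => i _; rewrite mule_ge0.
rewrite muleC; apply: le_trans (esum_leZl _ _ _) => //; last exact: poweR_ge0.
by apply: le_esum => i _; rewrite muleC lee_wpmul2r.
Qed.

Lemma esum_geometric_nat (x : R) : (0 <= x < 1)%R ->
  \esum_(i in [set: nat]) (x ^+ i)%:E <= ((1 - x)^-1)%:E.
Proof.
move=> /andP[x0 x1]; rewrite -nneseries_esumT; last first.
  by move=> n; rewrite lee_fin exprn_ge0.
apply: lime_le; first by apply: is_cvg_nneseries => n _ _; rewrite lee_fin exprn_ge0.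
apply: nearW => n; rewrite sumEFin lee_fin big_mkord.
have := subrX1 x n; rewrite -opprB -[(x - 1)%R]opprB mulNr => /oppr_inj e.
have x1' : (0 < 1 - x)%R by rewrite subr_gt0.
rewrite -(ler_pM2l x1') -e mulfV ?gt_eqF//.
by rewrite lerBlDr lerDl exprn_ge0.
Qed.

(** The bound does not depend on the centre [j], by translation. *)
Lemma esum_geometric_int (d : R) (d0 : (0 < d)%R) : exists2 C : R, (0 < C)%R &
  forall j : int,
  \esum_(i in [set: int]) (2 `^ (- d * `|(j - i)%:~R|))%:E <= C%:E.
Proof.
pose x : R := (2 `^ (- d))%R.
have x0 : (0 < x)%R by rewrite powR_gt0.
have x1 : (x < 1)%R.
  rewrite lt_neqAle powR_eq1 oppr_eq0 (gt_eqF d0) orbF pnatr_eq1 ltrn0/=.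
  by rewrite -[leRHS](powRr0 2%R) ler_powR ?ler1n// oppr_le0 ltW.
exists ((1 - x)^-1 + (1 - x)^-1)%R.
  by rewrite addr_gt0// invr_gt0 subr_gt0.
move=> j.
rewrite (@reindex_esum _ _ _ [set: int] _ (fun i => j - i)%R); last first.
  split => //.
  - by move=> a b _ _ /= /(congr1 (fun t => j - t)%R); rewrite !subKr.
  - by move=> a _; exists (j - a)%R => //; rewrite subKr.
under eq_esum do rewrite subKr.
rewrite (esumID (range Posz))/=; last by move=> i _; rewrite lee_fin powR_ge0.
rewrite EFinD; apply: leeD.
- rewrite setTI (@reindex_esum _ _ _ [set: nat] _ Posz); last first.
    by split => // a b _ _ [].
  apply: le_trans (esum_geometric_nat _); last by rewrite ltW.
  apply: le_esum => i _; rewrite lee_fin /= -powR_mulrn ?powR_ge0//.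
  by rewrite -powRrM ger0_norm.
- rewrite setTI (@reindex_esum _ _ _ [set: nat] _ Negz); last first.
    split => //; first by move=> i _ [k _ ?].
      by move=> a b _ _ [].
    by move=> [i|i] h; [exfalso; apply: h; exists i|exists i].
  apply: le_trans (esum_geometric_nat _); last by rewrite ltW.
  apply: le_esum => i _; rewrite lee_fin /= -powR_mulrn ?powR_ge0//.
  rewrite -powRrM ler_powR ?ler1n// NegzE mulrNz normrN !mulNr lerN2.
  by rewrite ler_pM2l// ger0_norm// ler_nat.
Qed.

(** A sum of products over all tuples is the product of the sums; the induction
peels off the first coordinate. *)
Lemma esum_tuple_prod (T : choiceType) (C : R) n (g : 'I_n -> T -> R) :
  (forall i t, 0 <= g i t)%R ->
  (forall i, \esum_(t in [set: T]) (g i t)%:E <= C%:E) ->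
  \esum_(l in [set: n.-tuple T]) (\prod_(i < n) g i (tnth l i))%:E <= (C ^+ n)%:E.
Proof.
elim: n g => [g _ _|n IH g g0 gC].
  rewrite (_ : [set: _] = [set [tuple]]); last first.
    by apply/seteqP; split => // x _; rewrite [x]tuple0.
  by rewrite esum_set1 ?big_ord0 ?expr0 // lee_fin.
rewrite (@reindex_esum _ _ _ [set: T * n.-tuple T] _
   (fun x => [tuple of x.1 :: x.2])); last first.
  split => //.
  - by move=> [a b] [a' b'] _ _ /= [-> ?]; congr pair; exact: val_inj.
  - move=> t _; exists (thead t, [tuple of behead t]) => //=.
    by rewrite [RHS]tuple_eta; exact: val_inj.
pose h (t : T) (l : n.-tuple T) :=
  (g ord0 t)%:E * (\prod_(i < n) g (lift ord0 i) (tnth l i))%:E.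
have h0 t l : 0 <= h t l by rewrite mule_ge0 ?lee_fin ?prodr_ge0.
rewrite [leLHS](_ : _ = \esum_(x in [set: T * n.-tuple T]) h x.1 x.2); last first.
  apply: eq_esum => -[t l] _; rewrite big_ord_recl EFinM /h tnth0.
  by congr (_ * (_)%:E); apply: eq_bigr => i _; rewrite tnthS.
rewrite esum_pair//.
have C0 : 0 <= C%:E.
  by apply: le_trans (gC ord0); apply: esum_ge0 => i _; rewrite lee_fin.
apply: (@le_trans _ _ (\esum_(t in [set: T]) ((C ^+ n)%:E * (g ord0 t)%:E))).
  apply: le_esum => t _; apply: le_trans (esum_leZl _ _ _) _.
  - by rewrite lee_fin.
  - by move=> l; rewrite lee_fin prodr_ge0.
  - rewrite [leRHS]muleC lee_wpmul2l ?lee_fin//.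
    exact: (IH (fun i => g (lift ord0 i))).
apply: le_trans (esum_leZl _ _ _) _ => //.
  by rewrite lee_fin exprn_ge0.
  by move=> i; rewrite lee_fin.
by rewrite exprSr EFinM lee_wpmul2l// lee_fin exprn_ge0.
Qed.

End esum_facts.

(** * One-dimensional cosine integrals *)

Section cosine_on_segment.
Context {R : realType}.
Implicit Types (x u a b th : R).

Lemma ler_norm_sin u : `|sin u| <= `|u|.
Proof.
have nn (v : R) : 0 <= v -> `|sin v| <= v.
  move=> v0; have [c _] := @MVT_segment R sin cos 0 v v0
    (fun t _ => is_derive_sin t)
    (continuous_subspaceT (@continuous_sin R)).
  rewrite sin0 !subr0 => ->; rewrite normrM (ger0_norm v0) ler_piMl//.
  exact: cos_max.
have [/nn u0|u0] := leP 0 u; first by apply: le_trans u0 _; exact: ler_norm.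
rewrite -[`|sin u|]normrN -sinN (ltr0_norm u0); apply: nn.
by rewrite oppr_ge0 ltW.
Qed.

Lemma sinB_prod u th : sin (th + u) - sin (th - u) = 2 * sin u * cos th.
Proof. by rewrite sinD sinB; ring. Qed.

(** With the phase at the midpoint, the integral of a cosine is again a cosine
times a factor that does not involve [th]; this makes the formula stable under
iterated integration without complex numbers. *)
Lemma integral_cos_segment x th a b : a < b -> x != 0 ->
  (\int[lebesgue_measure]_(t in `[a, b]) (cos (th + x * t))%:E)%E
  = (2 * sin (x * (b - a) / 2) / x * cos (th + x * ((a + b) / 2)))%:E.
Proof.
move=> ab x0.
pose F t := sin (th + x * t) / x.
have dF (t : R) : is_derive t (1:R) F (cos (th + x * t)).
  have -> : F = (fun t => x^-1 *: sin (th + x * t)).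
    by apply/funext => s; rewrite /F mulrC.
  have H : is_derive t (1:R) (fun s => th + x * s) x.
    have := @is_deriveD R R R (cst th) ( *%R x) t 1 0 x.
    rewrite add0r; apply.
    have := @is_deriveZ R R R id x t 1 1; rewrite /GRing.scale/= mulr1.
    by apply; exact: is_derive_id.
  have := @is_deriveZ R R R _ x^-1 t 1 _
    (@is_derive1_comp R sin (fun s => th + x * s) t _ _
      (is_derive_sin (th + x * t)) H).
  rewrite /GRing.scale/= (mulrC x^-1) -mulrA [x * x^-1]mulfV// mulr1.
  by [].
have cF : continuous F.
  move=> t; apply: differentiable_continuous; apply/derivable1_diffP.
  exact: (@ex_derive _ _ _ _ _ _ _ (dF t)).
rewrite (@continuous_FTC2 _ _ F)//.
- rewrite -EFinB; congr EFin; rewrite /F -mulrBl.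
  have -> : th + x * b = (th + x * ((a + b) / 2)) + x * (b - a) / 2 by field.
  have -> : th + x * a = (th + x * ((a + b) / 2)) - x * (b - a) / 2 by field.
  by rewrite sinB_prod mulrAC.
- apply: continuous_subspaceT => t.
  apply: continuous_comp; last exact: continuous_cos.
  apply: cvgD; first exact: cvg_cst.
  exact: mulrl_continuous.
- split.
  + by move=> t _; exact: (@ex_derive _ _ _ _ _ _ _ (dF t)).
  + by apply: cvg_at_right_filter; exact: cF.
  + by apply: cvg_at_left_filter; exact: cF.
- by move=> t _; rewrite derive1E; exact: (@derive_val _ _ _ _ _ _ _ (dF t)).
Qed.

Lemma segment_factor_le x d : x != 0 -> 0 <= d ->
  `|2 * sin (x * d / 2) / x| <= Num.min d (2 / `|x|).
Proof.
move=> x0 d0; have nx : 0 < `|x| by rewrite normr_gt0.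
rewrite !normrM normfV (ger0_norm (ler0n _ 2)) le_min; apply/andP; split.
  rewrite ler_pdivrMr//; apply: le_trans (ler_wpM2l _ (ler_norm_sin _)) _ => //.
  by rewrite !normrM normfV (ger0_norm d0) (ger0_norm (ler0n _ 2)) mulrC divfK// mulrC.
rewrite ler_pM2r ?invr_gt0// -[leRHS]mulr1 ler_wpM2l//; exact: sin_max.
Qed.

End cosine_on_segment.

(** * Product sets and cosine integrals over boxes, for the Borel measure *)

Section borel_boxes.
Context {R : realType}.
Local Notation mR := (measurableTypeR R).
Local Notation leb := (@lebesgue_measure R).

Definition prodset n (A : 'I_n -> set R) : set (n.-tuple mR) :=
  [set y | forall i, A i (tnth y i)].

Lemma measurable_prodset n (A : 'I_n -> set mR) :
  (forall i, measurable (A i)) -> measurable (prodset A).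
Proof.
move=> mA; rewrite (_ : prodset A =
    \bigcap_(i in [set: 'I_n]) ((fun y => tnth y i) @^-1` A i)); last first.
  by apply/seteqP; split=> y /= h i; [move=> _; exact: h|exact: (h i I)].
apply: fin_bigcap_measurable => // i _; rewrite -[X in measurable X]setTI.
exact: (measurable_tnth i).
Qed.

Lemma lebesgue_setT : leb [set: R] = +oo%E.
Proof. by rewrite -set_itvNyy lebesgue_measure_itv. Qed.

Lemma preimage_prodset n (A : 'I_n.+1 -> set R) :
  @cons_pair R n @^-1` prodset A =
  A ord0 `*` prodset (fun i => A (lift ord0 i)).
Proof.
apply/seteqP; split => -[t y] /=.
  move=> h; split; first by have := h ord0; rewrite tnth0.
  by move=> i; have := h (lift ord0 i); rewrite tnthS.
move=> [h0 h] i; case: (unliftP ord0 i) => [j|] ->; first by rewrite tnthS; exact: h.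
by rewrite tnth0.
Qed.

Lemma borel_prodset n (A : 'I_n -> set mR) (c : 'I_n -> R) :
  (forall i, measurable (A i)) -> (forall i, leb (A i) = (c i)%:E) ->
  borel_lebesgue n (prodset A) = (\prod_(i < n) c i)%:E.
Proof.
elim: n A c => [A c _ _|n IH A c mA Ac].
  rewrite big_ord0 /= diracE mem_set//; by case.
rewrite big_ord_recl EFinM /= /cons_measure /pushforward preimage_prodset.
rewrite product_measure1E//; last exact: measurable_prodset.
by congr (_ * _)%E; [exact: Ac|exact: (IH _ (fun i => c (lift ord0 i)))].
Qed.

(** This cannot be read off [borel_prodset], where the other coordinates range
over sets of finite measure. *)
Lemma borel_hyperplane n (i : 'I_n) (A : set mR) : measurable A -> leb A = 0%E ->
  borel_lebesgue n [set y | A (tnth y i)] = 0%E.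
Proof.
move=> mA A0; elim: n i => [[]//|n IH i].
rewrite /= /cons_measure /pushforward.
case: (unliftP ord0 i) => [j|] ->.
  rewrite (_ : _ @^-1` _ = setT `*` [set y : n.-tuple mR | A (tnth y j)]); last first.
    by apply/seteqP; split => -[t y] /=; rewrite tnthS// => -[].
  rewrite product_measure1E ?IH ?mule0//.
  rewrite -[X in measurable X]setTI; exact: (measurable_tnth j).
rewrite (_ : _ @^-1` _ = A `*` setT); last first.
  by apply/seteqP; split => -[t y] /=; rewrite tnth0// => -[].
by rewrite product_measure1E// [X in (X * _)%E](_ : _ = 0%E) ?mul0e.
Qed.

Lemma borel_setT n : (1 <= n)%N -> borel_lebesgue n [set: n.-tuple mR] = +oo%E.
Proof.
have pos m : (0 < borel_lebesgue m [set: m.-tuple mR])%E.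
  elim: m => [|m IH]; first by rewrite /= diracE mem_set// lte_fin.
  rewrite /= /cons_measure /pushforward preimage_setT -setXTT.
  rewrite product_measure1E// [X in (X * _)%E](_ : _ = +oo%E).
    by rewrite gt0_mulye.
  exact: lebesgue_setT.
case: n => // n _; rewrite /= /cons_measure /pushforward preimage_setT -setXTT.
rewrite product_measure1E// [X in (X * _)%E](_ : _ = +oo%E).
    by rewrite gt0_mulye//; exact: pos.
  exact: lebesgue_setT.
Qed.

Lemma measurable_phase n (x : 'I_n -> R) th :
  measurable_fun [set: n.-tuple mR]
    (fun y : n.-tuple mR => cos (th + \sum_(i < n) x i * tnth y i)).
Proof.
apply: measurableT_comp; first exact: continuous_measurable_fun (@continuous_cos R).
apply: measurable_funD => //; apply: measurable_sum => i.
by apply: measurable_funM => //; exact: (measurable_tnth i).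
Qed.

(** Induction on [n]: integrating out the last coordinates contributes their
factors and shifts the phase [th] seen by the first one. *)
Lemma integral_cos_box n (a b x : 'I_n -> R) th :
  (forall i, a i < b i) -> (forall i, x i != 0) ->
  (\int[borel_lebesgue n]_(y in prodset (fun i => [set` `[a i, b i]%R]))
     (cos (th + \sum_(i < n) x i * tnth y i))%:E)%E
  = (\prod_(i < n) (2 * sin (x i * (b i - a i) / 2) / x i)
     * cos (th + \sum_(i < n) x i * ((a i + b i) / 2)))%:E.
Proof.
move=> ab x0; elim: n => [|n IH] in a b x th ab x0 *.
  rewrite !big_ord0 mul1r addr0 (_ : prodset _ = setT); last first.
    by apply/seteqP; split => // y _ [].
  under eq_integral do rewrite big_ord0 addr0.
  by rewrite integral_cst//= diracE mem_set// mule1.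
set D := prodset _.
have mD : measurable D by exact: measurable_prodset.
have Doo : (borel_lebesgue n.+1 D < +oo)%E.
  rewrite (@borel_prodset _ _ (fun i => b i - a i)) ?ltry// => i.
  by rewrite lebesgue_measure_itv/= lte_fin ab -EFinD.
pose f y := cos (th + \sum_(i < n.+1) x i * tnth y i).
pose A0 : set R := [set` `[a ord0, b ord0]%R].
pose D' : set (n.-tuple mR) :=
  prodset (fun i => [set` `[a (lift ord0 i), b (lift ord0 i)]%R]).
have mD' : measurable D' by exact: measurable_prodset.
have mA0 : measurable (A0 : set mR) by exact: measurable_itv.
have preD : @cons_pair R n @^-1` D = A0 `*` D' by rewrite preimage_prodset.
have mf : measurable_fun [set: n.+1.-tuple mR] (EFin \o f).
  by apply/measurable_EFinP; exact: measurable_phase.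
pose nu := (leb \x borel_lebesgue n)%E.
have nuoo : (nu (A0 `*` D') < +oo)%E by move: Doo; rewrite /= /cons_measure /pushforward preD.
have if' : nu.-integrable (A0 `*` D') ((EFin \o f) \o @cons_pair R n).
  apply: measurable_bounded_integrable => //; first exact: measurableX.
    apply: measurable_funTS; apply: measurableT_comp (measurable_phase _ _) _.
    exact: measurable_cons_pair.
  exists 1; split => // M M1 y _ /=; apply: le_trans (ltW M1); exact: cos_max.
rewrite [LHS](_ : _ = \int[pushforward nu (@cons_pair R n)]_(y in D) (EFin \o f) y)%E//.
rewrite integral_pushforward//; [|exact: measurable_cons_pair|by rewrite preD].
rewrite preD integral_mkcond -integral12_prod_meas1; last first.
  by rewrite -integrable_mkcond//; exact: measurableX.
have lA0 : (leb A0 < +oo)%E.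
  by rewrite lebesgue_measure_itv/= lte_fin ab -EFinD ltry.
pose K := \prod_(i < n) (2 * sin (x (lift ord0 i) *
  (b (lift ord0 i) - a (lift ord0 i)) / 2) / x (lift ord0 i)).
pose T := \sum_(i < n) x (lift ord0 i) *
  ((a (lift ord0 i) + b (lift ord0 i)) / 2).
rewrite [LHS](_ : _ = \int[leb]_(t in A0) (K%:E * (cos ((th + T) + x ord0 * t))%:E))%E.
  rewrite integralZl//; last first.
    apply: measurable_bounded_integrable => //.
    - apply: measurable_funTS; apply: measurableT_comp; last first.
        by apply: measurable_funD => //; exact: measurable_funM.
      exact: continuous_measurable_fun (@continuous_cos R).
    - exists 1; split => // M M1 y _ /=; apply: le_trans (ltW M1); exact: cos_max.
  rewrite integral_cos_segment// -EFinM !big_ord_recl /K /T; congr EFin.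
  rewrite [LHS]mulrCA -[RHS]mulrA; congr (_ * (_ * cos _)).
  by rewrite addrA [RHS]addrAC.
rewrite [RHS]integral_mkcond; apply: eq_integral => t _.
rewrite [RHS]patchE; case: ifPn => [|/negP] tA; last first.
  apply: integral0_eq => s _; rewrite patchE; case: ifPn => //.
  by rewrite in_setX => /andP[].
transitivity (\int[borel_lebesgue n]_(s in D')
  (cos ((th + x ord0 * t) + \sum_(i < n) x (lift ord0 i) * tnth s i))%:E)%E.
  rewrite [RHS]integral_mkcond; apply: eq_integral => s _.
  rewrite !patchE in_setX tA /=; case: ifP => // _.
  rewrite /f big_ord_recl tnth0 addrA; congr (cos (_ + _))%:E.
  by apply: eq_bigr => i _; rewrite tnthS.
rewrite (IH _ _ (fun i => x (lift ord0 i)))// -EFinM; congr (_ * cos _)%:E.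
by rewrite addrAC.
Qed.

End borel_boxes.

(** * From the Borel measure to the Lebesgue measure of R^n *)

Lemma integral_measure_preserving d1 d2 (X : measurableType d1)
    (Y : measurableType d2) (R : realType) (phi : X -> Y)
    (m1 : {measure set X -> \bar R}) (m2 : {measure set Y -> \bar R})
    (D : set Y) (f : Y -> \bar R) :
  measurable_fun [set: X] phi ->
  (forall A, measurable A -> m1 (phi @^-1` A) = m2 A) ->
  measurable_fun [set: Y] f ->
  m1.-integrable (phi @^-1` D) (f \o phi) -> measurable D ->
  (\int[m1]_(x in phi @^-1` D) (f \o phi) x = \int[m2]_(y in D) f y)%E.
Proof.
move=> mphi m12 mf if_ mD.
rewrite -(integral_pushforward mphi mf if_ mD).
by apply: eq_measure_integral => A mA _; exact: m12.
Qed.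

Section lebesgue_Rn_facts.
Context {R : realType} {n : nat}.
Local Notation mR := (measurableTypeR R).
Local Notation leb := (@lebesgue_measure R).
Local Notation mu := (lebesgue_Rn R n).

Lemma measurable_Rn (A : set (n.-tuple mR)) :
  measurable A -> measurable (A : set (Rn R n)).
Proof. exact: caratheodory_measurable_mu_ext. Qed.

Lemma lebesgue_RnE (A : set (n.-tuple mR)) : measurable A ->
  mu A = borel_lebesgue n A.
Proof. exact: measurable_mu_extE. Qed.

Lemma measurable_Rn_id :
  measurable_fun [set: Rn R n] (id : Rn R n -> n.-tuple mR).
Proof. by move=> _ B mB; rewrite setTI; exact: measurable_Rn. Qed.

Lemma measurable_coord (i : 'I_n) :
  measurable_fun [set: Rn R n] (fun x : Rn R n => tnth x i : R).
Proof. exact: measurableT_comp (measurable_tnth i) measurable_Rn_id. Qed.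

(** The measure [mu] packed with its sigma-finiteness, as Fubini requires. *)
Definition sf_lebesgue_Rn : {sigma_finite_measure set (Rn R n) -> \bar R} :=
  HB.pack (Measure.sort mu) (Measure_isSigmaFinite.Build _ _ _ mu
    (completed_measure_extension_sigma_finite (sigma_finiteT _))).

(** The identity from R^n with the Lebesgue sets to R^n with the Borel sets
preserves measure. *)
Lemma integral_borel_Rn (h : n.-tuple mR -> R) (D : set (n.-tuple mR)) :
  measurable_fun [set: _] h -> (forall y, `|h y| <= 1) ->
  measurable D -> (borel_lebesgue n D < +oo)%E ->
  (\int[mu]_(y in D) (h y)%:E = \int[borel_lebesgue n]_(y in D) (h y)%:E)%E.
Proof.
move=> mh h1 mD Doo.
have ih : mu.-integrable ((id : Rn R n -> n.-tuple mR) @^-1` D)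
    ((EFin \o h) \o (id : Rn R n -> n.-tuple mR)).
  apply: measurable_bounded_integrable.
  - exact: measurable_Rn.
  - by apply: le_lt_trans Doo; rewrite -lebesgue_RnE.
  - by apply: measurable_funTS; exact: measurableT_comp mh measurable_Rn_id.
  - by exists 1; split => // M M1 y _ /=; apply: le_trans (ltW M1).
apply: (integral_measure_preserving measurable_Rn_id _ _ ih mD).
  exact: lebesgue_RnE.
exact/measurable_EFinP.
Qed.

Implicit Types Q : n.-tuple R * n.-tuple R.

Lemma boxE Q : box Q = prodset (fun i => [set` `[tnth Q.1 i, tnth Q.2 i]%R]).
Proof. by apply/seteqP; split => y h i; have := h i; rewrite /= in_itv. Qed.

Lemma measurable_box_borel Q : measurable (box Q : set (n.-tuple mR)).
Proof. by rewrite boxE; apply: measurable_prodset. Qed.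

Lemma measurable_box Q : measurable (box Q : set (Rn R n)).
Proof. exact: measurable_Rn (measurable_box_borel Q). Qed.

Lemma borel_box Q : M Q -> borel_lebesgue n (box Q) = (volume Q)%:E.
Proof.
move=> MQ; rewrite boxE (@borel_prodset _ _ _ (side Q))// => i.
by rewrite lebesgue_measure_itv/= lte_fin (MQ i) -EFinD.
Qed.

(** Bound for the modulus at [x] of the Fourier transform of the indicator of
[Q], valid off the coordinate hyperplanes. *)
Definition box_factor Q (x : Rn R n) : R :=
  \prod_(i < n) Num.min (side Q i) (2 / `|tnth x i|).

Lemma box_factor_ge0 Q x : M Q -> 0 <= box_factor Q x.
Proof.
move=> MQ; apply: prodr_ge0 => i _; rewrite le_min subr_ge0 (ltW (MQ i)) /=.
by rewrite divr_ge0.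
Qed.

Lemma integral_cos_box_le Q ph (x : Rn R n) : M Q -> (forall i, tnth x i != 0) ->
  (`|\int[mu]_(y in box Q) (cos (ph + dotp y x))%:E| <= (box_factor Q x)%:E)%E.
Proof.
move=> MQ x0.
have e y : ph + dotp y x = ph + \sum_(i < n) tnth x i * tnth y i.
  by congr (_ + _); apply: eq_bigr => i _; rewrite mulrC.
under eq_integral do rewrite e.
rewrite (@integral_borel_Rn (fun y => cos (ph + \sum_(i < n) tnth x i * tnth y i))).
- rewrite boxE integral_cos_box// abse_EFin lee_fin normrM -[leRHS]mulr1.
  apply: ler_pM => //; last exact: cos_max.
  rewrite normr_prod; apply: ler_prod => i _; rewrite normr_ge0 /=.
  by apply: segment_factor_le => //; rewrite subr_ge0 ltW.
- exact: measurable_phase.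
- by move=> y; exact: cos_max.
- exact: measurable_box_borel.
- by rewrite borel_box// ltry.
Qed.

Lemma measurable_dotp : measurable_fun [set: Rn R n * Rn R n]
  (fun z : Rn R n * Rn R n => dotp z.1 z.2).
Proof.
apply: measurable_sum => i; apply: measurable_funM.
  exact: measurableT_comp (measurable_coord i) measurable_fst.
exact: measurableT_comp (measurable_coord i) measurable_snd.
Qed.

Lemma ae_coord_neq0 : {ae mu, forall x, forall i, tnth x i != 0}.
Proof.
apply: filter_forall => i.
pose H : set (n.-tuple mR) := [set y | [set 0 : R] (tnth y i)].
have mH : measurable H.
  rewrite -[X in measurable X]setTI; apply: (measurable_tnth i) => //.
exists H; split; first exact: measurable_Rn.
  rewrite lebesgue_RnE// /H; apply: borel_hyperplane => //.
  exact: lebesgue_measure_set1.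
by move=> x /= /negP; rewrite negbK => /eqP.
Qed.

End lebesgue_Rn_facts.

(** * Integral transforms with a bounded kernel *)

Section bounded_kernel.
Context d1 d2 (X : measurableType d1) (Y : measurableType d2) (R : realType).
Variables (m1 : {sigma_finite_measure set X -> \bar R})
  (m2 : {sigma_finite_measure set Y -> \bar R}).
Variables (B : set X) (g : Y -> R) (c : X * Y -> R).
Hypotheses (mB : measurable B) (Boo : (m1 B < +oo)%E)
  (ig : m2.-integrable [set: Y] (EFin \o g))
  (mc : measurable_fun [set: X * Y] c) (c1 : forall z, `|c z| <= 1).

Let mg : measurable_fun [set: Y] g.
Proof. by apply/measurable_EFinP; case/integrableP: ig. Qed.

Let F (z : X * Y) : \bar R := (\1_B z.1 * (g z.2 * c z))%:E.

Let mF : measurable_fun [set: X * Y] F.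
Proof.
apply/measurable_EFinP; apply: measurable_funM.
  exact: measurableT_comp (measurable_indic mB) measurable_fst.
apply: measurable_funM => //; exact: measurableT_comp mg measurable_snd.
Qed.

Let igc y : m2.-integrable [set: Y] (fun x => (g x * c (y, x))%:E).
Proof.
apply: le_integrable ig => //.
- apply/measurable_EFinP; apply: measurable_funM => //.
  exact: measurableT_comp mc (pair1_measurable y).
- by move=> x _ /=; rewrite lee_fin normrM -[leRHS]mulr1 ler_wpM2l.
Qed.

Definition kernel_transform (y : X) : R := \int[m2]_x (g x * c (y, x)).

Let FE y : fubini_F m2 F y = ((EFin \o kernel_transform) \_ B) y.
Proof.
rewrite /fubini_F /F /= patchE indicE; case: ifPn => yB /=.
  under eq_integral do rewrite mul1r.
  rewrite /kernel_transform /Rintegral fineK//.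
  exact: integrable_fin_num (igc y).
by under eq_integral do rewrite mul0r; rewrite integral0.
Qed.

Let iF : (m1 \x m2)%E.-integrable [set: X * Y] F.
Proof.
apply/integrable12ltyP => //.
pose G := (\int[m2]_x `|(g x)%:E|)%E.
apply: (@le_lt_trans _ _ (\int[m1]_y ((\1_B y)%:E * G))%E).
  apply: ge0_le_integral => //.
  - by move=> y _; exact: integral_ge0.
  - apply: (measurable_fun_fubini_tonelli_F (m2 := m2) (abse \o F)) => //=.
    exact: measurableT_comp.
  - by apply: emeasurable_funM => //; exact/measurable_EFinP/measurable_indic.
  - move=> y _; rewrite -ge0_integralZl//; last first.
      by apply: measurableT_comp => //; exact/measurable_EFinP.
    apply: ge0_le_integral => //.
    + apply: measurableT_comp => //; apply/measurable_EFinP.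
      apply: (measurable_funM (measurable_cst (\1_B y : R))).
      apply: (measurable_funM mg).
      exact: measurableT_comp mc (pair1_measurable y).
    + apply: emeasurable_funM => //; apply: measurableT_comp => //.
      exact/measurable_EFinP.
    + move=> x _; rewrite lee_fin normrM ger0_norm//.
      by rewrite ler_wpM2l// normrM -[leRHS]mulr1 ler_wpM2l.
rewrite ge0_integralZr//; last 2 first.
  exact/measurable_EFinP/measurable_indic.
  exact: integral_ge0.
rewrite integral_indic// setIT; case/integrableP: ig => _ goo.
by rewrite lte_mul_pinfty// ge0_fin_numE.
Qed.

Lemma integrable_kernel_transform :
  m1.-integrable B (EFin \o kernel_transform).
Proof.
by apply/(integrable_mkcond _ mB); rewrite -(funext FE); exact: integrable_fubini_F iF.
Qed.

Let GE x : (\int[m1]_y F (y, x) = (g x)%:E * \int[m1]_(y in B) (c (y, x))%:E)%E.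
Proof.
have icx : m1.-integrable B (EFin \o (fun y => c (y, x))).
  apply: measurable_bounded_integrable => //.
    by apply: measurable_funTS; exact: measurableT_comp mc (pair2_measurable x).
  by exists 1; split => // M' M1 y _ /=; apply: le_trans (ltW M1).
rewrite -(integralZl mB icx) [RHS]integral_mkcond.
apply: eq_integral => y _; rewrite /F patchE indicE /=.
by case: ifPn => _ /=; rewrite ?mul1r ?mul0r// EFinM.
Qed.

(** Fubini: integrating the transform over [B] amounts to integrating [g]
against the integral over [B] of the kernel. *)
Lemma integral_kernel_transform_le (K : Y -> R) :
  measurable_fun [set: Y] K -> (forall x, 0 <= K x) ->
  {ae m2, forall x, (`|\int[m1]_(y in B) (c (y, x))%:E| <= (K x)%:E)%E} ->
  (`|\int[m1]_(y in B) (kernel_transform y)%:E|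
   <= \int[m2]_x (`|g x| * K x)%:E)%E.
Proof.
move=> mK K0 cK.
rewrite [X in (`|X|)%E](_ : _ = \int[m2]_x \int[m1]_y F (y, x))%E; last first.
  rewrite integral_mkcond -(Fubini iF).
  by apply: eq_integral => y _; rewrite -FE.
have mFG := measurable_fubini_G iF.
apply: le_trans (le_abse_integral _ _ _) _ => //.
apply: ae_ge0_le_integral => //.
- exact: measurableT_comp.
- by move=> x _; rewrite lee_fin mulr_ge0.
- by apply/measurable_EFinP; apply: measurable_funM => //; exact: measurableT_comp.
- apply: filterS cK => x cKx _.
  by rewrite GE abseM EFinM; apply: lee_wpmul2l.
Qed.

End bounded_kernel.

(** * Integrals of a Fourier transform over boxes *)

Section fourier_box.
Context {R : realType} {n : nat}.
Local Notation mu := (lebesgue_Rn R n).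
Local Notation smu := (@sf_lebesgue_Rn R n).
Implicit Types (g : Rn R n -> R) (Q : n.-tuple R * n.-tuple R).

Definition phase_kernel ph (z : Rn R n * Rn R n) : R := cos (ph + dotp z.1 z.2).

Definition cosine_transform g ph : Rn R n -> R := kernel_transform smu g (phase_kernel ph).

Lemma cosine_transformE g ph y : cosine_transform g ph y = \int[mu]_x (g x * cos (ph + dotp y x)).
Proof. by []. Qed.

Lemma measurable_min_inv (d : R) :
  measurable_fun [set: R] (fun t : R => Num.min d (2 / `|t|)).
Proof.
rewrite (_ : (fun t : R => _) = (cst d \min (fun t : R => 2 * `|t| `^ (-1)))).
  apply: measurable_minr => //; apply: measurable_funM => //.
  exact: measurableT_comp (measurable_powR _) (@normr_measurable R setT).
by apply/funext => t /=; rewrite powR_inv1.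
Qed.

Lemma measurable_box_factor Q :
  measurable_fun [set: Rn R n] (box_factor Q).
Proof.
apply: (@measurable_prod _ (Rn R n) R setT 'I_n _
  (fun i x => Num.min (side Q i) (2 / `|tnth x i|))) => i _.
exact: (measurableT_comp (measurable_min_inv (side Q i)) (measurable_coord i)).
Qed.

Lemma measurable_phase_kernel ph :
  measurable_fun [set: Rn R n * Rn R n] (phase_kernel ph).
Proof.
have h := measurable_funD (measurable_cst ph) (@measurable_dotp R n).
exact: (measurableT_comp (continuous_measurable_fun (@continuous_cos R)) h).
Qed.

Lemma lebesgue_box_lty Q : M Q -> (mu (box Q) < +oo)%E.
Proof.
by move=> MQ; rewrite lebesgue_RnE ?borel_box ?ltry//; exact: measurable_box_borel.
Qed.

Lemma phase_kernel_le1 ph z : `|phase_kernel ph z| <= 1.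
Proof. exact: cos_max. Qed.

Lemma integrable_cosine_transform g ph Q : M Q -> mu.-integrable [set: Rn R n] (EFin \o g) ->
  mu.-integrable (box Q) (EFin \o cosine_transform g ph).
Proof.
move=> MQ ig.
have h := @integrable_kernel_transform _ _ (Rn R n) (Rn R n) R smu smu (box Q) g
  (phase_kernel ph) (measurable_box Q) (lebesgue_box_lty MQ) ig
  (measurable_phase_kernel ph) (phase_kernel_le1 ph).
exact: h.
Qed.

Lemma integral_cosine_transform_le g ph Q : M Q -> mu.-integrable [set: Rn R n] (EFin \o g) ->
  (`|\int[mu]_(y in box Q) (cosine_transform g ph y)%:E|
   <= \int[mu]_x (`|g x| * box_factor Q x)%:E)%E.
Proof.
move=> MQ ig.
have cK : {ae mu, forall x, (`|\int[mu]_(y in box Q) (phase_kernel ph (y, x))%:E|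
    <= (box_factor Q x)%:E)%E}.
  have ff : Filter (almost_everywhere mu) by exact: ae_filter_ringOfSetsType.
  by apply: filterS (@ae_coord_neq0 R n) => x x0; exact: integral_cos_box_le.
have h := @integral_kernel_transform_le _ _ (Rn R n) (Rn R n) R smu smu (box Q) g
  (phase_kernel ph) (measurable_box Q) (lebesgue_box_lty MQ) ig
  (measurable_phase_kernel ph) (phase_kernel_le1 ph) (box_factor Q)
  (measurable_box_factor Q) (fun x => box_factor_ge0 x MQ) cK.
exact: h.
Qed.

Lemma integrable_cos_mul g ph (y : Rn R n) : mu.-integrable [set: Rn R n] (EFin \o g) ->
  mu.-integrable [set: Rn R n] (EFin \o (fun x => g x * cos (ph + dotp y x))).
Proof.
move=> ig; have /measurable_EFinP mg : measurable_fun [set: Rn R n] (EFin \o g).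
  by case/integrableP: ig.
have mc : measurable_fun [set: Rn R n] (fun x : Rn R n => cos (ph + dotp y x)).
  have h i : measurable_fun [set: Rn R n] (fun x : Rn R n => tnth y i * tnth x i).
    exact: (measurable_funM (measurable_cst (tnth y i)) (measurable_coord i)).
  have hs : measurable_fun [set: Rn R n] (fun x : Rn R n => ph + dotp y x).
    exact: (measurable_funD (measurable_cst ph) (measurable_sum _ h)).
  exact: (measurableT_comp (continuous_measurable_fun (@continuous_cos R)) hs).
apply: le_integrable ig; first exact: measurableT.
- by apply/measurable_EFinP; exact: (measurable_funM mg mc).
- move=> x _ /=; rewrite lee_fin normrM -[leRHS]mulr1 ler_wpM2l//.
  exact: cos_max.
Qed.

Local Notation cabs := (@Normc.normc R).

Lemma cabs_ge_Re (z : R[i]) : `|complex.Re z| <= cabs z.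
Proof.
case: z => a b /=; rewrite -sqrtr_sqr ler_sqrt; last by rewrite addr_ge0// sqr_ge0.
by rewrite lerDl sqr_ge0.
Qed.

Lemma cabs_ge_Im (z : R[i]) : `|complex.Im z| <= cabs z.
Proof.
case: z => a b /=; rewrite -sqrtr_sqr ler_sqrt; last by rewrite addr_ge0// sqr_ge0.
by rewrite lerDr sqr_ge0.
Qed.

Lemma cabs_ge0 (z : R[i]) : 0 <= cabs z.
Proof. by case: z => a b /=; exact: sqrtr_ge0. Qed.

Lemma cabs_le (z : R[i]) : cabs z <= `|complex.Re z| + `|complex.Im z|.
Proof.
case: z => a b /=; rewrite -[leRHS]ger0_norm ?addr_ge0// -sqrtr_sqr.
rewrite ler_sqrt ?sqr_ge0// sqrrD !real_normK ?num_real//.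
by rewrite addrAC lerDl mulrn_wge0// mulr_ge0.
Qed.

Lemma measurable_cabs (f : Rn R n -> R[i]) : cmeasurable f ->
  measurable_fun [set: Rn R n] (fun x => cabs (f x)).
Proof.
move=> [mr mi].
rewrite (_ : (fun x => _) = (fun x => Num.sqrt
   (complex.Re (f x) ^+ 2 + complex.Im (f x) ^+ 2))); last first.
  by apply/funext => x; case: (f x).
have h := measurable_funD (measurable_funX 2 mr) (measurable_funX 2 mi).
exact: (measurableT_comp (continuous_measurable_fun (@sqrt_continuous R)) h).
Qed.

Section L1_function.
Variables (f : Rn R n -> R[i]) (L1f : L1 f).
Let a x := complex.Re (f x).
Let b x := complex.Im (f x).

Let iabs : mu.-integrable [set: Rn R n] (EFin \o (fun x => cabs (f x))).
Proof.
have mc := measurable_cabs (proj1 L1f).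
apply/integrableP; split; first exact/measurable_EFinP.
case: L1f => _; congr (_ < _)%E.
by apply: eq_integral => x _ /=; rewrite ger0_norm// cabs_ge0.
Qed.

Let ia : mu.-integrable [set: Rn R n] (EFin \o a).
Proof.
apply: le_integrable iabs; first exact: measurableT.
  by apply/measurable_EFinP; case: L1f => -[].
by move=> x _; rewrite lee_fin (ger0_norm (cabs_ge0 _)) cabs_ge_Re.
Qed.

Let ib : mu.-integrable [set: Rn R n] (EFin \o b).
Proof.
apply: le_integrable iabs; first exact: measurableT.
  by apply/measurable_EFinP; case: L1f => -[].
by move=> x _; rewrite lee_fin (ger0_norm (cabs_ge0 _)) cabs_ge_Im.
Qed.

(** The sine parts are cosines shifted by a quarter period, so that a single
real transform serves for both components. *)
Lemma Re_fourier y :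
  complex.Re (fourier f y) = cosine_transform a 0 y + cosine_transform b (- (pi / 2)) y.
Proof.
rewrite !cosine_transformE -RintegralD; [|exact: measurableT|exact: integrable_cos_mul..].
apply: eq_Rintegral => x _; rewrite /a /b /cexpi; case: (f x) => u v /=.
by rewrite add0r cosN sinN [- (pi / 2) + _]addrC cosBpihalf; ring.
Qed.

Lemma Im_fourier y :
  complex.Im (fourier f y) = cosine_transform b 0 y + cosine_transform a (pi / 2) y.
Proof.
rewrite !cosine_transformE -RintegralD; [|exact: measurableT|exact: integrable_cos_mul..].
apply: eq_Rintegral => x _; rewrite /a /b /cexpi; case: (f x) => u v /=.
by rewrite add0r cosN sinN [pi / 2 + _]addrC cosDpihalf; ring.
Qed.

Lemma integral_box_cosine_le (g h : Rn R n -> R) t s Q : M Q ->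
  (forall x, `|g x| <= cabs (f x)) -> (forall x, `|h x| <= cabs (f x)) ->
  mu.-integrable [set: Rn R n] (EFin \o g) ->
  mu.-integrable [set: Rn R n] (EFin \o h) ->
  ((`|\int[mu]_(y in box Q) (cosine_transform g t y + cosine_transform h s y)|)%:E <=
  2%:E * \int[mu]_x (cabs (f x) * box_factor Q x)%:E)%E.
Proof.
move=> MQ gf hf ig ih.
have iG := integrable_cosine_transform t MQ ig; have iH := integrable_cosine_transform s MQ ih.
have mcK : measurable_fun [set: Rn R n] (fun x => (cabs (f x) * box_factor Q x)%:E).
  apply/measurable_EFinP.
  exact: (measurable_funM (measurable_cabs (proj1 L1f)) (measurable_box_factor Q)).
have bnd (k : Rn R n -> R) ph : (forall x, `|k x| <= cabs (f x)) ->
  mu.-integrable [set: Rn R n] (EFin \o k) ->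
  ((`|\int[mu]_(y in box Q) cosine_transform k ph y|)%:E <=
    \int[mu]_x (cabs (f x) * box_factor Q x)%:E)%E.
  move=> kf ik; have iK := integrable_cosine_transform ph MQ ik.
  have mk : measurable_fun [set: Rn R n] k.
    by apply/measurable_EFinP; case/integrableP: ik.
  have finK : (\int[mu]_(y in box Q) (cosine_transform k ph y)%:E)%E \is a fin_num.
    have := integrable_fin_num (measurable_box Q) iK; exact.
  rewrite /Rintegral -fine_abse//.
  rewrite fineK ?abse_fin_num//.
  apply: le_trans (integral_cosine_transform_le ph MQ ik) _.
  apply: ge0_le_integral; [exact: measurableT| | |exact: mcK|].
  - by move=> x _; rewrite lee_fin mulr_ge0// box_factor_ge0.
  - apply/measurable_EFinP.
    have mk' := measurableT_comp (@normr_measurable R setT) mk.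
    exact: (measurable_funM mk' (measurable_box_factor Q)).
  - by move=> x _; rewrite lee_fin ler_wpM2r// box_factor_ge0.
rewrite RintegralD; [|exact: measurable_box|exact: iG|exact: iH].
apply: (@le_trans _ _ ((`|\int[mu]_(y in box Q) cosine_transform g t y|)%:E +
  (`|\int[mu]_(y in box Q) cosine_transform h s y|)%:E)%E).
  by rewrite -EFinD lee_fin ler_normD.
rewrite (_ : 2%:E = 1 + 1)%E; last by rewrite -EFinD.
have I0 : (0 <= \int[mu]_x (cabs (f x) * box_factor Q x)%:E)%E.
  apply: integral_ge0 => x _; rewrite lee_fin mulr_ge0 ?cabs_ge0//.
  exact: box_factor_ge0.
by rewrite ge0_muleDl// !mul1e leeD// bnd.
Qed.

Lemma cabs_box_fourier_le Q : M Q ->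
  ((cabs (cintegral (box Q) (fourier f)))%:E <=
  4%:E * \int[mu]_x (cabs (f x) * box_factor Q x)%:E)%E.
Proof.
move=> MQ.
apply: (@le_trans _ _ (2%:E * (\int[mu]_x (cabs (f x) * box_factor Q x)%:E) +
  2%:E * (\int[mu]_x (cabs (f x) * box_factor Q x)%:E))%E); last first.
  have I0 : (0 <= \int[mu]_x (cabs (f x) * box_factor Q x)%:E)%E.
    apply: integral_ge0 => x _; rewrite lee_fin mulr_ge0 ?cabs_ge0//.
    exact: box_factor_ge0.
  by rewrite -ge0_muleDl// -EFinD (_ : (2 + 2 = 4 :> R)%R)// -natrD.
apply: (@le_trans _ _ ((`|complex.Re (cintegral (box Q) (fourier f))|)%:E +
   (`|complex.Im (cintegral (box Q) (fourier f))|)%:E)%E).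
  by rewrite -EFinD lee_fin cabs_le.
apply: leeD.
- have -> : complex.Re (cintegral (box Q) (fourier f))
      = \int[mu]_(y in box Q) (cosine_transform a 0 y + cosine_transform b (- (pi / 2)) y).
    by apply: eq_Rintegral => y _; exact: Re_fourier.
  apply: integral_box_cosine_le => // x; [exact: cabs_ge_Re|exact: cabs_ge_Im].
- have -> : complex.Im (cintegral (box Q) (fourier f))
      = \int[mu]_(y in box Q) (cosine_transform b 0 y + cosine_transform a (pi / 2) y).
    by apply: eq_Rintegral => y _; exact: Im_fourier.
  apply: integral_box_cosine_le => // x; [exact: cabs_ge_Im|exact: cabs_ge_Re].
Qed.

End L1_function.

End fourier_box.

(** * Integrals and countable families of sets *)

Section countable_cover.
Context d (T : measurableType d) (R : realType) (mu : {measure set T -> \bar R}).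
Context (I : countType).

(** Sums over a countable type become series, which can be integrated term by
term by monotone convergence. *)
Lemma nneseries_pickle (b : I -> \bar R) : (forall i, 0 <= b i)%E ->
  (\sum_(k <oo) oapp b 0 (pickle_inv k) = \esum_(i in [set: I]) b i)%E.
Proof.
move=> b0; rewrite nneseries_esumT; last by move=> k; case: pickle_inv.
pose pk (i : I) : nat := pickle i.
have bij : set_bij [set: I] (range pk) pk.
  split.
  - by move=> i _; exists i.
  - by move=> i j _ _ /(pcan_inj pickleK).
  - by move=> k [i _ <-]; exists i.
have := @reindex_esum R _ _ _ _ _ (fun k => oapp b 0%E (pickle_inv k)) bij.
under [RHS]eq_esum do rewrite /pk pickleK_inv /=.
move=> <-; rewrite [RHS]esum_mkcond; apply: eq_esum => k _; case: ifPn => // kp.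
have := @pickle_invK I k; case: pickle_inv => //= i ik.
by move/negP: kp; rewrite inE; case; exists i.
Qed.

Section indicator_sum.
Variables (A : I -> set T) (c : I -> R).
Hypotheses (mA : forall i, measurable (A i)) (c0 : forall i, 0 <= c i).

Let t i x : \bar R := ((c i)%:E * (\1_(A i) x)%:E)%E.
Let t0 i x : (0 <= t i x)%E. Proof. by rewrite mule_ge0// lee_fin. Qed.
Let mt i : measurable_fun [set: T] (t i).
Proof. by apply: emeasurable_funM => //; exact/measurable_EFinP/measurable_indic. Qed.
Let t' k x : \bar R := oapp (t ^~ x) 0%E (pickle_inv k).
Let t'0 k x : (0 <= t' k x)%E.
Proof. by rewrite /t'; case: pickle_inv => //= i; exact: t0. Qed.
Let mt' k : measurable_fun [set: T] (t' k).
Proof.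
by rewrite /t'; case: pickle_inv => [i|] /=; [exact: mt|exact: measurable_cst].
Qed.
Let tE x : (\esum_(i in [set: I]) ((c i)%:E * (\1_(A i) x)%:E) = \sum_(k <oo) t' k x)%E.
Proof. by rewrite -nneseries_pickle// => i; exact: t0. Qed.

Lemma measurable_esum_indic : measurable_fun [set: T]
  (fun x => \esum_(i in [set: I]) ((c i)%:E * (\1_(A i) x)%:E))%E.
Proof. by under eq_fun do rewrite tE; exact: ge0_emeasurable_sum. Qed.

Lemma integral_esum_indic :
  (\int[mu]_x (\esum_(i in [set: I]) ((c i)%:E * (\1_(A i) x)%:E)) =
   \esum_(i in [set: I]) ((c i)%:E * mu (A i)))%E.
Proof.
under eq_integral do rewrite tE.
rewrite integral_nneseries// -nneseries_pickle; last by move=> i; rewrite mule_ge0// lee_fin.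
apply: eq_eseriesr => k _; rewrite /t'; case: pickle_inv => [i|] /=.
  rewrite /t ge0_integralZl//; last 2 first.
  - exact/measurable_EFinP/measurable_indic.
  - by rewrite lee_fin.
  by rewrite integral_indic// setIT.
by rewrite integral0.
Qed.

(** The sets need not be disjoint: where they overlap the right-hand side only
gets larger. *)
Lemma integral_le_cover (h : T -> R) :
  measurable_fun [set: T] h -> (forall x, 0 <= h x) ->
  (forall i x, A i x -> h x <= c i) ->
  {ae mu, forall x, h x = 0 \/ exists i, A i x} ->
  (\int[mu]_x (h x)%:E <= \esum_(i in [set: I]) ((c i)%:E * mu (A i)))%E.
Proof.
move=> mh h0 hc cover; rewrite -integral_esum_indic.
apply: ae_ge0_le_integral => //.
- by move=> x _; rewrite lee_fin.
- exact/measurable_EFinP.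
- by move=> x _; apply: esum_ge0 => i _; exact: t0.
- exact: measurable_esum_indic.
- apply: filterS cover => x + _; case=> [->|[i Aix]].
    by apply: esum_ge0 => i _; exact: t0.
  apply: le_trans (@esum_ge1 _ _ (fun i => t i x) i _); last by move=> j; exact: t0.
  by rewrite /t indicE mem_set//= -EFinM mulr1 lee_fin; exact: hc Aix.
Qed.

End indicator_sum.

End countable_cover.

(** The integral of a nonnegative function is a supremum over the simple
functions below it, hence monotone without measurability.  This spares the
measurability of the integrand of the Lorentz norm. *)
Lemma le_integral_nonneg d (T : measurableType d) (R : realType)
    (mu : {measure set T -> \bar R}) (f g : T -> \bar R) :
  (forall x, 0 <= f x)%E -> (forall x, f x <= g x)%E ->
  (\int[mu]_x f x <= \int[mu]_x g x)%E.
Proof.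
move=> f0 fg; rewrite !ge0_integralTE//; last by move=> x; exact: le_trans (fg x).
apply: ge_ereal_sup => _ [h /= hf <-]; apply: ereal_sup_ubound; exists h => //= x.
exact: le_trans (fg x).
Qed.

Lemma esum_measure_le d (T : measurableType d) (R : realType)
    (mu : {measure set T -> \bar R}) (I : choiceType) (A : I -> set T) (B : set T) :
  measurable B -> (forall i, measurable (A i)) -> (forall i, A i `<=` B) ->
  (forall i j x, A i x -> A j x -> i = j) ->
  (\esum_(i in [set: I]) mu (A i) <= mu B)%E.
Proof.
move=> mB mA AB dA; apply: ge_ereal_sup => _ [X [fX _] <-].
have tA : trivIset X A by move=> i j _ _ [x [Ai Aj]]; exact: dA Ai Aj.
rewrite -(measure_fin_bigcup mu fX tA)//.
apply: le_measure; rewrite ?inE//.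
  exact: fin_bigcup_measurable.
by move=> x [i _]; exact: AB.
Qed.

(** * The non-increasing rearrangement *)

Section decreasing_rearrangement.
Context d (T : measurableType d) (R : realType) (mu : {measure set T -> \bar R}).
Variable F : T -> R.
Hypotheses (mF : measurable_fun [set: T] F) (F0 : forall x, 0 <= F x)
  (Foo : (\int[mu]_x (F x)%:E < +oo)%E) (muT : mu [set: T] = +oo%E).

(** The rearrangement of a nonnegative function on an arbitrary measure space. *)
Definition rearr (t : R) : \bar R := ereal_inf [set s%:E | s in
    [set s : R | (mu [set x | (s < F x)%R] <= t%:E)%E]].

Lemma measurable_superlevel (s : R) : measurable [set x | s < F x].
Proof.
rewrite (_ : [set x | s < F x] = setT `&` F @^-1` `]s, +oo[%classic); last first.
  by rewrite setTI; apply/seteqP; split => x /=; rewrite in_itv/= andbT.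
by apply: mF => //; exact: measurable_itv.
Qed.

Lemma chebyshev_superlevel (s : R) : 0 < s ->
  (s%:E * mu [set x | (s < F x)%R] <= \int[mu]_x (F x)%:E)%E.
Proof.
move=> s0; set A := [set x | _]; have mA : measurable A by exact: measurable_superlevel.
have mi : measurable_fun [set: T] (fun x => (\1_A x)%:E : \bar R).
  by apply/measurable_EFinP; exact: measurable_indic.
rewrite -[X in mu X]setIT -integral_indic// -ge0_integralZl//; last first.
  by rewrite lee_fin ltW.
apply: ge0_le_integral => //.
- by move=> x _; rewrite mule_ge0// lee_fin ltW.
- exact: emeasurable_funM.
- exact/measurable_EFinP.
- move=> x _; rewrite indicE -EFinM lee_fin; case: (boolP (x \in A)) => /=; last by rewrite mulr0.
  by rewrite inE mulr1 => /ltW.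
Qed.

(** A negative level is exceeded everywhere, that is, on a set of infinite
measure. *)
Lemma superlevel_le_ge0 (s t : R) : (mu [set x | (s < F x)%R] <= t%:E)%E -> 0 <= s.
Proof.
move=> st; rewrite leNgt; apply/negP => s0; move: st.
rewrite (_ : [set x | s < F x] = setT) ?muT ?leNgt ?ltry//.
by apply/seteqP; split => // x _ /=; exact: lt_le_trans (F0 x).
Qed.

Lemma rearr_ge0 t : (0 <= rearr t)%E.
Proof.
by apply: le_ereal_inf_tmp => _ [s /= st <-]; rewrite lee_fin; exact: superlevel_le_ge0 st.
Qed.

Lemma rearr_le (t s : R) : (mu [set x | (s < F x)%R] <= t%:E)%E -> (rearr t <= s%:E)%E.
Proof. by move=> st; apply: ereal_inf_lbound; exists s. Qed.

Lemma rearr_le_chebyshev (t s : R) : 0 < s ->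
  (\int[mu]_x (F x)%:E <= (s * t)%:E)%E -> (rearr t <= s%:E)%E.
Proof.
move=> s0 st; apply: rearr_le; rewrite -(@lee_pmul2l _ s%:E) ?lte_fin//.
by rewrite -EFinM; apply: le_trans (chebyshev_superlevel s0) st.
Qed.

Let IF : R := fine (\int[mu]_x (F x)%:E).
Let IFE : (\int[mu]_x (F x)%:E)%E = IF%:E.
Proof.
rewrite fineK// ge0_fin_numE//.
by apply: integral_ge0 => x _; rewrite lee_fin.
Qed.
Let IF0 : 0 <= IF.
Proof. by apply: fine_ge0; apply: integral_ge0 => x _; rewrite lee_fin. Qed.

Lemma rearr_fin (t : R) : 0 < t -> rearr t \is a fin_num.
Proof.
move=> t0; rewrite ge0_fin_numE ?rearr_ge0//.
apply: (@le_lt_trans _ _ ((IF + 1) / t)%:E); last exact: ltry.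
apply: rearr_le_chebyshev; first by rewrite divr_gt0// ltr_wpDl.
by rewrite IFE lee_fin divfK ?gt_eqF// lerDl.
Qed.

(** By Chebyshev's inequality the rearrangement of an integrable function tends
to 0 at infinity; this gives an explicit point. *)
Lemma rearr_small (e : R) : 0 < e -> (rearr (IF / e) <= e%:E)%E.
Proof.
move=> e0; apply: rearr_le_chebyshev => //.
by rewrite IFE lee_fin mulrC divfK ?gt_eqF.
Qed.

Lemma rearr_nonincreasing (s t : R) : s <= t -> (rearr t <= rearr s)%E.
Proof.
move=> st; apply: ereal_inf_le_tmp => _ [u us <-]; exists u => //=.
by apply: le_trans us _; rewrite lee_fin.
Qed.

(** The infimum that defines the rearrangement is attained, since the
distribution function is right-continuous (continuity of the measure from
below). *)
Lemma superlevel_rearr (t : R) : 0 < t ->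
  (mu [set x | (fine (rearr t) < F x)%R] <= t%:E)%E.
Proof.
move=> t0; set v := fine _.
have vE : rearr t = v%:E by rewrite fineK// rearr_fin.
(* The levels v + 1 / (k + 1) exceed the infimum, so that some s below each of
   them has a superlevel set of measure at most t. *)
pose G (k : nat) := [set x | v + k.+1%:R^-1 < F x].
have GU : [set x | v < F x] = \bigcup_k G k.
  apply/seteqP; split => [x /= vF|x [k _ /=]]; last first.
    by apply: lt_trans; rewrite ltrDl invr_gt0.
  have [k vk] := ltr_add_invr vF.
  by exists k.
have mG k : measurable (G k) by exact: measurable_superlevel.
rewrite GU.
have cG : (mu \o G) k @[k --> \oo] --> mu (\bigcup_k G k).
  apply: nondecreasing_cvg_mu => //; first exact: bigcupT_measurable.
  move=> m k mk; apply/subsetPset => x /=; apply: le_lt_trans.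
  by rewrite lerD2l lef_pV2 ?posrE// ler_nat ltnS.
rewrite -(cvg_lim _ cG)//; apply: lime_le; first by apply/cvg_ex; eexists; exact: cG.
apply: nearW => k /=.
have : (rearr t < (v + k.+1%:R^-1)%:E)%E by rewrite vE lte_fin ltrDl invr_gt0.
move=> /ereal_inf_lt[_ [s /= st <-]]; rewrite lte_fin => sv.
apply: le_trans st; apply: le_measure; rewrite ?inE.
- exact: mG.
- exact: measurable_superlevel.
- by move=> x /=; exact: lt_trans.
Qed.

End decreasing_rearrangement.

(** * Powers of two and dyadic rings *)

Section powers_of_two.
Context {R : realType}.
Implicit Types s t : R.

Definition exp2 t : R := 2 `^ t.

Lemma exp2_gt0 t : 0 < exp2 t. Proof. exact: powR_gt0. Qed.
Lemma exp2_ge0 t : 0 <= exp2 t. Proof. exact: powR_ge0. Qed.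
Lemma exp2D s t : exp2 (s + t) = exp2 s * exp2 t.
Proof. by rewrite /exp2 powRD// pnatr_eq0 implybT. Qed.
Lemma exp2N t : exp2 (- t) = (exp2 t)^-1. Proof. exact: powRN. Qed.
Lemma exp20 : exp2 0 = 1. Proof. exact: powRr0. Qed.
Lemma exp21 : exp2 1 = 2. Proof. by rewrite /exp2 powRr1. Qed.
Lemma exp2M s t : exp2 (s * t) = exp2 s `^ t. Proof. exact: powRrM. Qed.
Lemma exp2_natr n : exp2 n%:R = 2 ^+ n. Proof. exact: powR_mulrn. Qed.
Lemma exp2_int (z : int) : exp2 z%:~R = 2 ^ z. Proof. exact: powR_intmul. Qed.

Lemma ltr_exp2 s t : (exp2 s < exp2 t) = (s < t).
Proof.
rewrite /exp2 /powR pnatr_eq0/= ltr_expR ltr_pM2r// ln_gt0//.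
by rewrite ltr1n.
Qed.
Lemma ler_exp2 s t : (exp2 s <= exp2 t) = (s <= t).
Proof. by rewrite !leNgt ltr_exp2. Qed.

Lemma exp2_sum n (F : 'I_n -> R) : exp2 (\sum_(i < n) F i) = \prod_(i < n) exp2 (F i).
Proof. by apply: (big_morph exp2 exp2D exp20). Qed.

Lemma exp2_log t : 0 < t -> exists s, t = exp2 s.
Proof.
move=> t0; exists (ln t / ln 2); rewrite /exp2 /powR pnatr_eq0/= divfK ?lnK//.
by rewrite gt_eqF// ln_gt0// ltr1n.
Qed.

Definition dyadic_ring (k : int) : set R :=
  [set t | exp2 (- k%:~R) <= `|t| < exp2 (1 - k%:~R)].

Lemma dyadic_ringE k : dyadic_ring k =
  `[exp2 (- k%:~R), exp2 (1 - k%:~R)[%classic `|`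
  `]- exp2 (1 - k%:~R), - exp2 (- k%:~R)]%classic.
Proof.
apply/seteqP; split => t; rewrite /dyadic_ring /= !in_itv /=.
  case: (ger0P t) => t0 /andP[h1 h2]; [left|right]; apply/andP; split; lra.
have h := exp2_gt0 (- k%:~R).
case=> /andP[h1 h2]; first by rewrite ger0_norm ?h1 ?h2//; lra.
by rewrite ler0_norm; [apply/andP; split; lra|lra].
Qed.

Lemma measurable_dyadic_ring k : measurable (dyadic_ring k : set (measurableTypeR R)).
Proof. by rewrite dyadic_ringE; apply: measurableU; exact: measurable_itv. Qed.

Lemma lebesgue_dyadic_ring k :
  @lebesgue_measure R (dyadic_ring k) = (2 * exp2 (- k%:~R))%:E.
Proof.
have h := exp2_gt0 (- k%:~R).
have e : exp2 (1 - k%:~R) = 2 * exp2 (- k%:~R) by rewrite exp2D exp21.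
rewrite dyadic_ringE measureU; [|exact: measurable_itv|exact: measurable_itv|].
  rewrite /= !lebesgue_measure_itv /= !lte_fin e !ifT; [|lra|lra].
  by rewrite -!EFinB -EFinD; congr EFin; lra.
apply/seteqP; split => t //=; rewrite !in_itv /=; case=> /andP[? ?] /andP[? ?]; lra.
Qed.

(** The index is the opposite of the integer part of the binary logarithm of
[`|t|]. *)
Lemma dyadic_ring_ex t : t != 0 -> exists k, dyadic_ring k t.
Proof.
move=> t0; have [s ts] : exists s, `|t| = exp2 s by apply: exp2_log; rewrite normr_gt0.
exists (- Num.floor s); rewrite /dyadic_ring /= ts ler_exp2 ltr_exp2.
have /andP[h1 h2] := floor_itv s; move: h2; rewrite intrD mulrNz => h2.
by rewrite opprK; apply/andP; split; lra.
Qed.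

Lemma dyadic_ring_inj k k' t : dyadic_ring k t -> dyadic_ring k' t -> k = k'.
Proof.
have half (a b : int) : dyadic_ring a t -> dyadic_ring b t -> b <= a.
  move=> /andP[a1 _] /andP[_ b2]; have := le_lt_trans a1 b2.
  rewrite ltr_exp2 => h; rewrite -ltzD1 -(ltr_int R) intrD; lra.
by move=> h h'; apply/eqP; rewrite eq_le !half.
Qed.

End powers_of_two.

(** * Dyadic shells of R^n *)

Section shells.
Context {R : realType} {n : nat}.
Local Notation mR := (measurableTypeR R).
Local Notation mu := (lebesgue_Rn R n).
Implicit Types (l m : n.-tuple int) (x : Rn R n) (Q : n.-tuple R * n.-tuple R).

Definition shell l : set (Rn R n) :=
  prodset (fun i => dyadic_ring (tnth l i) : set R).

Lemma measurable_shell l : measurable (shell l).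
Proof.
by apply: measurable_Rn; apply: measurable_prodset => i; exact: measurable_dyadic_ring.
Qed.

Lemma lebesgue_shell l :
  mu (shell l) = (exp2 (n%:R - \sum_(i < n) (tnth l i)%:~R))%:E.
Proof.
have mA i : measurable (dyadic_ring (tnth l i) : set mR).
  exact: measurable_dyadic_ring.
rewrite lebesgue_RnE; last exact: measurable_prodset.
rewrite (@borel_prodset _ _ _ (fun i => 2 * exp2 (- (tnth l i)%:~R)))//; last first.
  by move=> i; exact: lebesgue_dyadic_ring.
rewrite big_split /= prodr_const card_ord exp2D exp2_natr -sumrN exp2_sum.
by [].
Qed.

Lemma shell_inj l l' x : shell l x -> shell l' x -> l = l'.
Proof.
by move=> h h'; apply: eq_from_tnth => i; exact: dyadic_ring_inj (h i) (h' i).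
Qed.

Lemma shell_ex x : (forall i, tnth x i != 0) -> exists l, shell l x.
Proof.
move=> x0; have [k hk] := fin_all_exists (fun i => dyadic_ring_ex (x0 i)).
by exists [tuple k i | i < n] => i; rewrite tnth_mktuple.
Qed.

(** Size on the shell [l] of the kernel attached to boxes with sides at least
[2 ^ m_i], up to a constant. *)
Definition decay m l : R :=
  \prod_(i < n) Num.min 1 (exp2 ((tnth l i)%:~R - (tnth m i)%:~R)).

Lemma decay_ge0 m l : 0 <= decay m l.
Proof. by apply: prodr_ge0 => i _; rewrite le_min ler01 exp2_ge0. Qed.

(** On the shell, [2 / `|x_i|] is at most [2 * 2 ^ l_i], and the sides only enter
through their lower bounds [2 ^ m_i]. *)
Lemma box_factor_shell Q m l x : M Q -> (forall i, dyadic m i <= side Q i) ->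
  shell l x -> (volume Q)^-1 * box_factor Q x <= 2 ^+ n * decay m l.
Proof.
move=> MQ mQ lx; rewrite /volume /box_factor -prodfV -big_split /=.
rewrite -[n in 2 ^+ n]card_ord -prodr_const -big_split /=.
apply: ler_prod => i _.
have s0 : 0 < side Q i by rewrite subr_gt0.
apply/andP; split.
  by rewrite mulr_ge0 ?invr_ge0 ?(ltW s0)// le_min (ltW s0) divr_ge0.
have /andP[xl _] := lx i.
have x0 : 0 < `|tnth x i| by apply: lt_le_trans xl; exact: exp2_gt0.
rewrite ler_pdivrMl//; rewrite ge_min; apply/orP.
have [lm|ml] := leP 1 (exp2 ((tnth l i)%:~R - (tnth m i)%:~R)).
  by left; lra.
right; rewrite mulrCA ler_pM2l//.
apply: (@le_trans _ _ (exp2 (tnth l i)%:~R)).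
  rewrite -[leRHS]invrK -exp2N lef_pV2 ?posrE// exp2_gt0//.
rewrite -[X in exp2 X](subrKC (tnth m i)%:~R) exp2D ler_wpM2r ?exp2_ge0//.
by have := mQ i; rewrite /dyadic -exp2_int.
Qed.

End shells.

(** * Level sets cut at dyadic values of the rearrangement *)

Section level_sets.
Context {R : realType} {n : nat}.
Hypothesis n0 : (1 <= n)%N.
Local Notation mu := (lebesgue_Rn R n).
Local Notation cabs := (@Normc.normc R).
Variables (f : Rn R n -> R[i]) (L1f : L1 f).

Let F x := cabs (f x).
Let mF : measurable_fun [set: Rn R n] F.
Proof. exact: measurable_cabs (proj1 L1f). Qed.
Let F0 x : 0 <= F x. Proof. exact: cabs_ge0. Qed.
Let Foo : (\int[mu]_x (F x)%:E < +oo)%E. Proof. exact: (proj2 L1f). Qed.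
Let muT : mu [set: Rn R n] = +oo%E.
Proof. by rewrite lebesgue_RnE// borel_setT. Qed.

Definition height (j : int) : R := fine (rearrangement f (exp2 j%:~R)).

Lemma rearrangement_fin t : 0 < t -> rearrangement f t \is a fin_num.
Proof. exact: rearr_fin mF F0 Foo muT t. Qed.

Lemma rearrangement_ge0 t : (0 <= rearrangement f t)%E.
Proof. exact: rearr_ge0 F0 muT t. Qed.

Lemma rearrangement_nonincreasing s t : s <= t ->
  (rearrangement f t <= rearrangement f s)%E.
Proof. exact: rearr_nonincreasing. Qed.

Lemma heightE j : rearrangement f (exp2 j%:~R) = (height j)%:E.
Proof. by rewrite fineK// rearrangement_fin// exp2_gt0. Qed.

Lemma height_ge0 j : 0 <= height j.
Proof. by apply: fine_ge0; exact: rearrangement_ge0. Qed.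

Definition level_set (j : int) : set (Rn R n) :=
  [set x | height (j + 1) < F x] `&` ~` [set x | height j < F x].

Lemma measurable_level_set j : measurable (level_set j).
Proof.
by apply: measurableI; [|apply: measurableC]; exact: measurable_superlevel.
Qed.

Lemma lebesgue_superlevel_height j :
  (mu [set x | (height j < F x)%R] <= (exp2 j%:~R)%:E)%E.
Proof.
have := superlevel_rearr mF F0 Foo muT (exp2_gt0 (j%:~R : R)).
by [].
Qed.

Lemma lebesgue_level_set_le j : (mu (level_set j) <= (exp2 (j%:~R + 1))%:E)%E.
Proof.
have := lebesgue_superlevel_height (j + 1); rewrite intrD; apply: le_trans.
by apply: le_measure; rewrite ?inE; [exact: measurable_level_set|
  exact: measurable_superlevel|exact: subIsetl].
Qed.

Lemma height_small e : 0 < e -> exists N : nat, height N%:Z <= e.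
Proof.
move=> e0; pose I := fine (\int[mu]_x (F x)%:E)%E.
have [N IN] : exists N : nat, I / e <= exp2 (N%:R).
  (* Any n is at most 2 ^ n. *)
  exists (Num.trunc (I / e)).+1; rewrite exp2_natr.
  have h := ltnW (ltn_expl (Num.trunc (I / e)).+1 (isT : 1 < 2)%N).
  rewrite -natrX; apply: le_trans (_ : (Num.trunc (I / e)).+1%:R <= _).
    exact/ltW/truncnS_gt.
  by rewrite ler_nat.
exists N; rewrite -lee_fin -heightE.
apply: le_trans (rearr_small mF F0 Foo e0).
exact: rearrangement_nonincreasing.
Qed.

(** The points above all the heights form a null set, because the part of R^n
above [height (- k)] has measure at most [2 ^ - k].  The heights tend to 0 at
+oo, so that any other point with [F x > 0] is caught between two consecutive
heights. *)
Lemma level_set_cover : {ae mu, forall x, F x = 0 \/ exists j, level_set j x}.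
Proof.
pose N := \bigcap_(k in [set: nat]) [set x | height (- k%:Z) < F x].
have mN : measurable N.
  by apply: bigcapT_measurable => k; exact: measurable_superlevel.
exists N; split => //.
  apply/eqP; rewrite eq_le measure_ge0 andbT; apply/lee_addgt0Pr => e e0.
  rewrite add0e.
  have [k ke] : exists k : nat, exp2 (- k%:R) <= e.
    exists (Num.trunc e^-1).+1; rewrite exp2N exp2_natr invf_ple ?posrE//.
    have h := ltnW (ltn_expl (Num.trunc e^-1).+1 (isT : 1 < 2)%N).
    rewrite -natrX; apply: le_trans (_ : (Num.trunc e^-1).+1%:R <= _).
      exact/ltW/truncnS_gt.
    by rewrite ler_nat.
  apply: le_trans (_ : ((exp2 (- k%:R))%:E <= _)%E); last by rewrite lee_fin.
  have := lebesgue_superlevel_height (- k%:Z); rewrite mulrNz; apply: le_trans.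
  apply: le_measure; rewrite ?inE//; first exact: measurable_superlevel.
  by move=> x /(_ k I).
move=> x /= h; apply: contrapT => xN; apply: h.
have [x0|x0] := eqVneq (F x) 0; [by left|right].
have Fx : 0 < F x by rewrite lt_neqAle eq_sym x0 F0.
have [k hk] : exists k : nat, F x <= height (- k%:Z).
  apply: contrapT => h; apply: xN => k _ /=; rewrite ltNge; apply/negP => h'.
  by apply: h; exists k.
have F2 : 0 < F x / 2 by rewrite divr_gt0.
have [N' hN] := height_small F2.
have ex : exists i : nat, height (- k%:Z + i%:Z) < F x.
  exists (k + N')%N; rewrite PoszD addKr; apply: le_lt_trans hN _; lra.
(* The least such i is positive, and the level set ends just before it. *)
case: (ex_minnP ex) => -[|i] hi imin.
  by move: hi; rewrite addr0 ltNge hk.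
exists (- k%:Z + i%:Z); split => /=.
  by rewrite -addrA -(_ : i.+1 = i%:Z + 1 :> int)//; lia.
by move=> /imin; rewrite ltnn.
Qed.

Lemma box_average_le_shells m :
  (box_average (fourier f) (dyadic m) <=
   (4 * 2 ^+ n)%:E * \esum_(z in [set: int * n.-tuple int])
     ((height z.1 * decay m z.2)%:E * mu (level_set z.1 `&` shell z.2)))%E.
Proof.
apply: ge_ereal_sup => _ [Q /= [MQ mQ] <-].
have V0 : 0 < volume Q by apply: prodr_gt0 => i _; rewrite subr_gt0.
rewrite EFinM; apply: (@le_trans _ _ ((volume Q)^-1%:E *
    (4%:E * \int[mu]_x (F x * box_factor Q x)%:E))%E).
  apply: lee_wpmul2l; first by rewrite lee_fin invr_ge0 ltW.
  exact: cabs_box_fourier_le.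
have mFb : measurable_fun [set: Rn R n] (fun x => F x * box_factor Q x).
  exact: (measurable_funM mF (measurable_box_factor Q)).
have Fb0 x : 0 <= F x * box_factor Q x by rewrite mulr_ge0// box_factor_ge0.
rewrite muleCA EFinM -muleA; apply: lee_wpmul2l; first by rewrite lee_fin.
have mFbE : measurable_fun [set: Rn R n] (fun x => (F x * box_factor Q x)%:E).
  exact/measurable_EFinP.
have iV0 : 0 <= (volume Q)^-1 by rewrite invr_ge0 ltW.
have FbE0 (x : Rn R n) : setT x -> (0 <= (F x * box_factor Q x)%:E)%E.
  by rewrite lee_fin.
rewrite -(ge0_integralZl_EFin mu measurableT FbE0 mFbE iV0).
under eq_integral do rewrite -EFinM.
have cover : {ae mu, forall x, (volume Q)^-1 * (F x * box_factor Q x) = 0 \/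
    exists z : int * n.-tuple int, (level_set z.1 `&` shell z.2) x}.
  have ff : Filter (almost_everywhere mu) by exact: ae_filter_ringOfSetsType.
  apply: filterS2 level_set_cover (@ae_coord_neq0 R n) => x [->|[j jx]] x0.
    by left; rewrite mul0r mulr0.
  by right; have [l lx] := shell_ex x0; exists (j, l).
apply: le_trans (integral_le_cover (c := fun z => 2 ^+ n * (height z.1 * decay m z.2))
  _ _ _ _ _ cover) _.
- move=> z; apply: measurableI; first exact: measurable_level_set.
  exact: measurable_shell.
- by move=> z; rewrite !mulr_ge0 ?height_ge0 ?decay_ge0 ?exprn_ge0.
- exact: (measurable_funM (measurable_cst (volume Q)^-1) mFb).
- by move=> x; rewrite mulr_ge0// invr_ge0 ltW.
- move=> z x [[_ /negP]]; rewrite -leNgt => Fx zx.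
  rewrite mulrCA [leRHS]mulrCA ler_pM// ?mulr_ge0 ?invr_ge0 ?box_factor_ge0 ?(ltW V0)//.
  exact: box_factor_shell.
under eq_esum do rewrite EFinM -muleA.
apply: esum_leZl; first by rewrite lee_fin exprn_ge0.
by move=> z; rewrite mule_ge0// lee_fin mulr_ge0 ?height_ge0 ?decay_ge0.
Qed.

End level_sets.

(** * Discrete kernels with geometric decay *)

Section dyadic_estimate.
Context {R : realType} (n : nat).
Implicit Types (l m : n.-tuple int).

(** Summable weight in [m - l]. *)
Definition spread (d : R) m l : R :=
  \prod_(i < n) exp2 (- d * `|(tnth m i - tnth l i)%:~R|).

Lemma spread_ge0 d m l : 0 <= spread d m l.
Proof. by apply: prodr_ge0 => i _; exact: exp2_ge0. Qed.

Lemma spreadE d m l :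
  spread d m l = exp2 (- d * \sum_(i < n) `|(tnth m i - tnth l i)%:~R|).
Proof. by rewrite mulr_sumr exp2_sum. Qed.

Lemma spreadC d m l : spread d m l = spread d l m.
Proof.
by apply: eq_bigr => i _; rewrite -normrN -mulrNz opprB.
Qed.

Lemma spread_powR d m l r : spread d m l `^ r = spread (d * r) m l.
Proof. by rewrite !spreadE -exp2M mulrAC !mulNr. Qed.

(** Coordinatewise, with [u = m_i - l_i], this says that
[min(1, 2^-u) 2^(u(1-a))] is [2^(-au)] for [u >= 0] and [2^(u(1-a))] for
[u < 0], both at most [2^(-d|u|)]. *)
Lemma decay_le (a d : R) m l : d <= a -> d <= 1 - a -> 0 <= a <= 1 ->
  decay m l <= spread d m l *
    exp2 (- (1 - a) * (\sum_(i < n) (tnth m i)%:~R - \sum_(i < n) (tnth l i)%:~R)).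
Proof.
move=> da d1a /andP[a0 a1].
rewrite -sumrB mulr_sumr exp2_sum -big_split /=; apply: ler_prod => i _.
rewrite le_min ler01 exp2_ge0 /= -exp2D intrB.
move: ((tnth m i)%:~R : R) ((tnth l i)%:~R : R) => x y.
rewrite ge_min; have [xy|xy] := leP y x.
  apply/orP; right; rewrite ler_exp2 ger0_norm ?subr_ge0//.
  rewrite -subr_ge0 [leRHS](_ : _ = (x - y) * (a - d)); last by ring.
  by rewrite mulr_ge0 ?subr_ge0.
apply/orP; left; rewrite -[leLHS]exp20 ler_exp2 ltr0_norm ?subr_lt0//.
rewrite [leRHS](_ : _ = (y - x) * (1 - a - d)); last by ring.
by rewrite mulr_ge0 ?subr_ge0// ltW.
Qed.

(** Here [ip] and [ir] stand for [1/p] and [1/r], and [e] for the mass of a level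
set in a shell.  Splitting [e] into the powers [ir], [a - ir] and [1 - a] trades
the two bounds on [e] for decay: the third power, bounded by the measure of the
shell, completes [decay_le], and the second one, bounded by [2 ^ (j + 1)], leaves
[2 ^ ((k + j) (a - ip))]. *)
Lemma decay_mass_le (ip ir d : R) m l (j : int) (e : R) :
  0 < ir -> ir < ip -> ip < 1 -> d <= ir -> d <= ip - ir -> d <= (1 - ip) / 2 ->
  0 <= e -> e <= exp2 (j%:~R + 1) -> e <= exp2 (n%:R - \sum_(i < n) (tnth l i)%:~R) ->
  exp2 ((\sum_(i < n) (tnth m i)%:~R) * (1 - ip)) * (decay m l * e) <=
  exp2 (n%:R + 1) * (spread d m l *
    exp2 (- d * `|\sum_(i < n) (tnth m i)%:~R + j%:~R|)) *
  (exp2 (j%:~R * ip) * (exp2 (- j%:~R) * e) `^ ir).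
Proof.
move=> ir0 irp p1 d1 d2 d3; rewrite le_eqVlt => /orP[/eqP <- _ _|e0].
  by rewrite !mulr0 !mulr_ge0 ?exp2_ge0 ?spread_ge0 ?powR_ge0.
have [x ->] := exp2_log e0; rewrite !ler_exp2 -exp2D -exp2M.
set k : R := \sum_(i < n) (tnth m i)%:~R; set L : R := \sum_(i < n) (tnth l i)%:~R.
set J : R := j%:~R; set N : R := n%:R => xJ xL.
(* The sign of a - ip must be opposite to that of k + j. *)
pose a := if 0 <= k + J then ir else (1 + ip) / 2.
have ha : [/\ d <= a, d <= 1 - a, 0 <= a <= 1 & ir <= a].
  by rewrite /a; case: ifP => _; split; rewrite ?lexx//; lra.
case: ha => da d1a a01 ira.
have ha : (k + J) * (a - ip) <= - d * `|k + J|.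
  rewrite /a; have [h|h] := leP 0 (k + J).
    rewrite ger0_norm// -subr_ge0 [leRHS](_ : _ = (k + J) * (ip - ir - d)); last by ring.
    by rewrite mulr_ge0//; lra.
  rewrite ltr0_norm// -subr_ge0 [leRHS](_ : _ = - (k + J) * ((1 - ip) / 2 - d)); last by field.
  by rewrite mulr_ge0//; lra.
apply: (@le_trans _ _ (exp2 (k * (1 - ip)) *
  (spread d m l * exp2 (- (1 - a) * (k - L)) * exp2 x))).
  by rewrite ler_wpM2l ?exp2_ge0// ler_wpM2r ?exp2_ge0// decay_le.
move/andP: a01 => [a0 a1].
have N0 : 0 <= N by rewrite ler0n.
have h1 : 0 <= (J + 1 - x) * (a - ir) by rewrite mulr_ge0//; lra.
have h2 : 0 <= (N - L - x) * (1 - a) by rewrite mulr_ge0//; lra.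
have h3 : 0 <= N * a by rewrite mulr_ge0.
rewrite [leLHS](_ : _ = spread d m l * exp2 (k * (1 - ip) - (1 - a) * (k - L) + x)); last first.
  by rewrite -mulNr !exp2D; ring.
rewrite [leRHS](_ : _ = spread d m l *
    exp2 (N + 1 - d * `|k + J| + J * ip + (- J + x) * ir)); last first.
  by rewrite -mulNr !exp2D; ring.
rewrite ler_wpM2l ?spread_ge0// ler_exp2 -subr_ge0.
rewrite [leRHS](_ : _ = (J + 1 - x) * (a - ir) + (N - L - x) * (1 - a) + N * a +
  (- d * `|k + J| - (k + J) * (a - ip)) + (1 - (a - ir))); last by ring.
have h4 : 0 <= - d * `|k + J| - (k + J) * (a - ip) by rewrite subr_ge0.
have h5 : 0 <= 1 - (a - ir) by lra.
exact: addr_ge0 (addr_ge0 (addr_ge0 (addr_ge0 h1 h2) h3) h4) h5.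
Qed.

End dyadic_estimate.

(** * Summation over the dyadic indices *)

Section dyadic_sums.
Context {R : realType} (n : nat).
Implicit Types (l m : n.-tuple int).
Local Open Scope ereal_scope.

Lemma sum_spread_le (d C : R) m :
  (forall j : int, \esum_(i in [set: int]) (2 `^ (- d * `|(j - i)%:~R|))%:E <= C%:E) ->
  \esum_(l in [set: n.-tuple int]) (spread d m l)%:E <= (C ^+ n)%:E.
Proof.
move=> hC; apply: (@esum_tuple_prod _ _ _ _
  (fun i t => exp2 (- d * `|(tnth m i - t)%:~R|)%R)) => [i t|i].
  exact: exp2_ge0.
exact: hC.
Qed.

Lemma sum_shift_le (d C : R) (k : int) :
  (forall j : int, \esum_(i in [set: int]) (2 `^ (- d * `|(j - i)%:~R|))%:E <= C%:E) ->
  \esum_(j in [set: int]) (exp2 (- d * `|k%:~R + j%:~R|))%:E <= C%:E.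
Proof.
move=> hC; apply: le_trans (hC (- k)%R); apply: le_esum => j _.
by rewrite -opprD mulrNz normrN intrD.
Qed.

(** The kernel of [decay_mass_le] is a square of a kernel [u] with half the decay:
one factor is spent in [esum_wpow], the other one is summed over [m].  The
remaining masses, summed over the shells, are bounded by [2 ^ (j + 1)], which
cancels the factor [2 ^ - j] coming from the power [ir] of [2 ^ - j * e]. *)
Lemma dyadic_sum_estimate (ip r : R) : (0 < r)%R -> (r^-1 < ip)%R -> (ip < 1)%R ->
  exists2 C : R, (0 < C)%R & exists2 d : R, (0 < d)%R &
  forall (e : int -> n.-tuple int -> R) (v : int -> R),
    (forall j l, 0 <= e j l)%R -> (forall j, 0 <= v j)%R ->
    (forall j l, e j l <= exp2 (n%:R - \sum_(i < n) (tnth l i)%:~R))%R ->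
    (forall j, \esum_(l in [set: n.-tuple int]) (e j l)%:E <= (exp2 (j%:~R + 1))%:E) ->
  forall k : int,
  (exp2 (k%:~R * (1 - ip) * r))%:E * (\esum_(m in Dset k)
    (\esum_(z in [set: int * n.-tuple int]) (v z.1 * decay m z.2 * e z.1 z.2)%:E) `^ r)
  <= C%:E * \esum_(j in [set: int])
       (exp2 (- d * `|k%:~R + j%:~R|) * (exp2 (j%:~R * ip) * v j) `^ r)%:E.
Proof.
move=> r0 rip ip1; set ir := r^-1%R; have ir0 : (0 < ir)%R by rewrite invr_gt0.
pose d : R := (Num.min ir (Num.min (ip - ir) ((1 - ip) / 2)))%R.
have d0 : (0 < d)%R by rewrite !lt_min ir0 subr_gt0 rip divr_gt0 ?subr_gt0.
have [d1 d2 d3] : [/\ d <= ir, d <= ip - ir & d <= (1 - ip) / 2]%R.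
  by split; rewrite /d !ge_min lexx ?orbT.
have [C1 C10 hC1] := @esum_geometric_int R (d / 2)%R ltac:(by rewrite divr_gt0).
have [C2 C20 hC2] := @esum_geometric_int R (d / 2 * r)%R ltac:(by rewrite mulr_gt0 ?divr_gt0).
pose A : R := exp2 (n%:R + 1)%R.
have A0 : (0 < A)%R by exact: exp2_gt0.
exists ((C1 ^+ n * C1) `^ r * (A `^ r * C2 ^+ n * 2))%R.
  by rewrite !(mulr_gt0, powR_gt0, exprn_gt0).
exists (d / 2 * r)%R; first by rewrite mulr_gt0 ?divr_gt0.
move=> e v e0 v0 e2 e3 k.
pose w (a : R) (j : int) : R := exp2 (- a * `|k%:~R + j%:~R|)%R.
have w0 a j : (0 <= w a j)%R by exact: exp2_ge0.
have e1 j l : (e j l <= exp2 (j%:~R + 1))%R.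
  rewrite -lee_fin; apply: le_trans (e3 j).
  by apply: (@esum_ge1 _ _ (fun l => (e j l)%:E)) => l'; rewrite lee_fin.
pose u m (z : int * n.-tuple int) : R := (w (d / 2) z.1 * spread (d / 2) m z.2)%R.
pose b j : R := (exp2 (j%:~R * ip) * v j)%R.
have b0 j : (0 <= b j)%R by rewrite mulr_ge0 ?exp2_ge0.
pose x m (z : int * n.-tuple int) : R :=
  (A * u m z * b z.1 * (exp2 (- z.1%:~R) * e z.1 z.2) `^ ir)%R.
have u0 m z : (0 <= u m z)%R by rewrite mulr_ge0 ?spread_ge0.
have x0 m z : (0 <= x m z)%R.
  exact: mulr_ge0 (mulr_ge0 (mulr_ge0 (ltW A0) (u0 m z)) (b0 z.1)) (powR_ge0 _ _).
have a0 m z : (0 <= v z.1 * decay m z.2 * e z.1 z.2)%R.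
  by rewrite !mulr_ge0 ?decay_ge0.
have uu (a : R) : (- (a / 2) - (a / 2) = - a)%R by field.
have step1 m : Dset k m ->
    (exp2 (k%:~R * (1 - ip))%R)%:E * (\esum_(z in [set: int * n.-tuple int])
      (v z.1 * decay m z.2 * e z.1 z.2)%:E)
    <= \esum_(z in [set: int * n.-tuple int]) ((u m z)%:E * (x m z)%:E).
  move=> mk; rewrite esumZl ?exp2_gt0//; last by move=> z; rewrite lee_fin.
  apply: le_esum => -[j l] _; rewrite -!EFinM lee_fin /=.
  have kE : (k%:~R = \sum_(i < n) (tnth m i)%:~R :> R)%R.
    by rewrite -mk rmorph_sum.
  have := decay_mass_le m ir0 rip ip1 d1 d2 d3 (e0 j l) (e1 j l) (e2 j l).
  rewrite -kE => /(ler_wpM2l (v0 j)) h.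
  rewrite [leLHS](_ : _ = v j * (exp2 (k%:~R * (1 - ip)) * (decay m l * e j l)))%R; last by ring.
  apply: le_trans h _; rewrite le_eqVlt; apply/orP; left; apply/eqP.
  rewrite /x /u /b /=.
  have -> : spread d m l = (spread (d / 2) m l * spread (d / 2) m l)%R.
    by rewrite !spreadE -exp2D -mulrDl uu.
  have -> : exp2 (- d * `|k%:~R + j%:~R|)%R = (w (d / 2) j * w (d / 2) j)%R.
    by rewrite /w -exp2D -mulrDl uu.
  by rewrite /A; ring.
have sumu m : \esum_(z in [set: int * n.-tuple int]) (u m z)%:E <= (C1 ^+ n * C1)%:E.
  rewrite (@esum_pair _ _ _ (fun j l => (u m (j, l))%:E)); last first.
    by move=> j l; rewrite lee_fin.
  apply: (@le_trans _ _ (\esum_(j in [set: int]) ((C1 ^+ n)%:E * (w (d / 2)%R j)%:E))).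
    apply: le_esum => j _; rewrite /u /=; under eq_esum do rewrite EFinM.
    apply: le_trans (esum_leZl _ _ _) _; rewrite ?lee_fin//.
      by move=> l; rewrite lee_fin spread_ge0.
    by rewrite muleC lee_wpmul2r ?lee_fin// sum_spread_le.
  apply: le_trans (esum_leZl _ _ _) _; rewrite ?lee_fin ?exprn_ge0 ?(ltW C10)//.
    by move=> j; rewrite lee_fin.
  by rewrite EFinM lee_wpmul2l ?lee_fin ?exprn_ge0 ?(ltW C10)// sum_shift_le.
pose c (z : int * n.-tuple int) : R :=
  (A `^ r * (w (d / 2 * r) z.1 * b z.1 `^ r) * (exp2 (- z.1%:~R) * e z.1 z.2))%R.
have c0 z : (0 <= c z)%R.
  apply: mulr_ge0; last by rewrite mulr_ge0 ?exp2_ge0.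
  exact: mulr_ge0 (powR_ge0 _ _) (mulr_ge0 (w0 _ _) (powR_ge0 _ _)).
have xr m z : ((x m z) `^ r = c z * spread (d / 2 * r) m z.2)%R.
  rewrite /x powRM ?powR_ge0//; last exact: mulr_ge0 (mulr_ge0 (ltW A0) (u0 m z)) (b0 z.1).
  rewrite powRM//; last exact: mulr_ge0 (ltW A0) (u0 m z).
  rewrite powRM ?(ltW A0)// /u powRM ?spread_ge0//.
  rewrite spread_powR -powRrM mulVf ?gt_eqF// powRr1 ?mulr_ge0 ?exp2_ge0//.
  rewrite /c (_ : w (d / 2) z.1 `^ r = w (d / 2 * r) z.1)%R; first by ring.
  by rewrite /w -exp2M mulrAC !mulNr.
have step2 m : Dset k m ->
   (exp2 (k%:~R * (1 - ip) * r)%R)%:E * (\esum_(z in [set: int * n.-tuple int])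
      (v z.1 * decay m z.2 * e z.1 z.2)%:E) `^ r
    <= ((C1 ^+ n * C1) `^ r)%:E * \esum_(z in [set: int * n.-tuple int])
      (c z * spread (d / 2 * r) m z.2)%:E.
  move=> mk; rewrite exp2M -[X in X * _ <= _]poweR_EFin -poweRM ?lee_fin ?exp2_ge0//; last first.
    by apply: esum_ge0 => z _; rewrite lee_fin.
  apply: le_trans (le_poweR (ltW r0) _ (step1 _ mk)) _.
    by rewrite mule_ge0 ?lee_fin ?exp2_ge0//; apply: esum_ge0 => z _; rewrite lee_fin.
  apply: le_trans (esum_wpow r0 _ _) _; try by move=> z; rewrite lee_fin.
  rewrite [X in _ * X <= _](@eq_esum _ _ _ _
    (fun z => (c z * spread (d / 2 * r) m z.2)%:E)); last first.
    by move=> z _; rewrite poweR_EFin xr.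
  apply: lee_wpmul2r; first by apply: esum_ge0 => z _; rewrite lee_fin mulr_ge0 ?spread_ge0.
  rewrite -poweR_EFin; apply: le_poweR => //; first exact: ltW.
  by apply: esum_ge0 => z _; rewrite lee_fin.
rewrite esumZl ?exp2_gt0//; last by move=> m; exact: poweR_ge0.
apply: (@le_trans _ _ (\esum_(m in [set: n.-tuple int]) (((C1 ^+ n * C1) `^ r)%:E *
   \esum_(z in [set: int * n.-tuple int]) (c z * spread (d / 2 * r) m z.2)%:E))).
  by apply: le_trans (le_esum step2) _; exact: esum_subset.
have cs0 m z : 0 <= (c z * spread (d / 2 * r) m z.2)%:E.
  by rewrite lee_fin mulr_ge0 ?spread_ge0.
apply: le_trans (esum_leZl _ _ _) _.
- by rewrite lee_fin powR_ge0.
- by move=> m; apply: esum_ge0.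
rewrite [X in _ <= X * _]EFinM -muleA; apply: lee_wpmul2l; first by rewrite lee_fin powR_ge0.
rewrite esum_exchange//.
apply: (@le_trans _ _ (\esum_(z in [set: int * n.-tuple int]) ((C2 ^+ n)%:E * (c z)%:E))).
  apply: le_esum => z _; under eq_esum do rewrite EFinM spreadC.
  apply: le_trans (esum_leZl _ _ _) _; rewrite ?lee_fin//.
    by move=> m; rewrite lee_fin spread_ge0.
  by rewrite muleC lee_wpmul2r ?lee_fin// sum_spread_le.
apply: le_trans (esum_leZl _ _ _) _;
  [by rewrite lee_fin exprn_ge0// ltW|by move=> z; rewrite lee_fin|].
rewrite (@esum_pair _ _ _ (fun j l => (c (j, l))%:E)); last first.
  by move=> j l; rewrite lee_fin.
apply: (@le_trans _ _ ((C2 ^+ n)%:E * \esum_(j in [set: int])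
    ((A `^ r * 2)%:E * (w (d / 2 * r)%R j * b j `^ r)%:E))).
  apply: lee_wpmul2l; first by rewrite lee_fin exprn_ge0// ltW.
  apply: le_esum => j _.
  rewrite /c /=; under eq_esum do rewrite mulrA EFinM.
  apply: le_trans (esum_leZl _ _ _) _;
    [by rewrite lee_fin !mulr_ge0 ?powR_ge0 ?exp2_ge0|by move=> l; rewrite lee_fin|].
  apply: (le_trans (lee_wpmul2l _ (e3 j))).
    by rewrite lee_fin !mulr_ge0 ?powR_ge0 ?exp2_ge0.
  rewrite -!EFinM lee_fin exp2D exp21 exp2N.
  have pj : (exp2 j%:~R != 0 :> R)%R by rewrite gt_eqF// exp2_gt0.
  rewrite le_eqVlt; apply/orP; left; apply/eqP; field.
  exact: pj.
rewrite -esumZl; [|by rewrite !mulr_gt0 ?powR_gt0|].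
  by rewrite muleA -EFinM mulrA [(C2 ^+ n * _)%R]mulrC.
by move=> j; rewrite lee_fin mulr_ge0 ?powR_ge0.
Qed.

End dyadic_sums.

(** * Dyadic form of the Lorentz norm *)

Section lorentz_sums.
Context {R : realType} {n : nat}.
Hypothesis n0 : (1 <= n)%N.
Local Notation mu := (lebesgue_Rn R n).
Variables (f : Rn R n -> R[i]) (L1f : L1 f).
Local Open Scope ereal_scope.

(** The rearrangement is at least [height f j] on the [j]-th block. *)
Definition block (j : int) : set R := `]exp2 (j%:~R - 1), exp2 j%:~R]%classic.

Lemma block_inj i j t : block i t -> block j t -> i = j.
Proof.
have half (a b : int) : block a t -> block b t -> (b <= a)%R.
  rewrite /block /= !in_itv /= => /andP[_ a1] /andP[b1 _].
  have := lt_le_trans b1 a1; rewrite ltr_exp2 => h.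
  by rewrite -ltzD1 -(ltr_int R) intrD; lra.
by move=> h h'; apply/eqP; rewrite eq_le !half.
Qed.

Lemma lebesgue_block j : @lebesgue_measure R (block j) = (exp2 (j%:~R - 1))%:E.
Proof.
have h := exp2_gt0 (j%:~R - 1 : R)%R.
have e : (exp2 j%:~R = 2 * exp2 (j%:~R - 1) :> R)%R by rewrite -exp21 -exp2D addrC subrK.
rewrite /block lebesgue_measure_itv /= lte_fin e ifT; last by lra.
by rewrite -EFinB; congr EFin; lra.
Qed.

(** On the block [j] the integrand is at least [c j], whose product with the
length of the block is the [j]-th term of the sum, up to the constant. *)
Lemma esum_height_le (p s : R) : (0 < p)%R -> (0 < s)%R ->
  \esum_(j in [set: int]) ((exp2 (j%:~R / p) * height f j) `^ s)%:E
  <= (2 * exp2 (s / p))%:E * lorentz_norm p s%:E f `^ s.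
Proof.
move=> p0 s0.
pose g (t : R) := ((t `^ p^-1)%:E * rearrangement f t) `^ s * (t^-1)%:E.
have -> : lorentz_norm p s%:E f `^ s = \int[lebesgue_measure]_(t in `]0%R, +oo[) g t.
  rewrite /lorentz_norm poweRVK//; apply: integral_ge0 => t /=.
  rewrite in_itv /= andbT => t0; rewrite mule_ge0 ?poweR_ge0//.
  by rewrite lee_fin invr_ge0 ltW.
rewrite integral_mkcond.
pose c (j : int) : R := (((exp2 ((j%:~R - 1) / p) * height f j) `^ s) * exp2 (- j%:~R))%R.
have c0 j : (0 <= c j)%R by rewrite mulr_ge0 ?powR_ge0 ?exp2_ge0.
have gc t j : block j t -> (c j)%:E <= g t.
  rewrite /block /= in_itv /= => /andP[t1 t2].
  have t0 : (0 < t)%R by apply: lt_trans t1; exact: exp2_gt0.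
  rewrite /c /g EFinM; apply: lee_pmul; rewrite ?lee_fin ?powR_ge0 ?exp2_ge0//.
    rewrite -[leLHS]poweR_EFin; apply: le_poweR; first exact: ltW.
      by rewrite lee_fin mulr_ge0 ?exp2_ge0// height_ge0.
    rewrite EFinM -heightE//; apply: lee_pmul; rewrite ?lee_fin ?exp2_ge0//.
    - exact: rearrangement_ge0.
    - rewrite exp2M; apply: ge0_ler_powR; rewrite ?nnegrE ?exp2_ge0 ?invr_ge0 ?(ltW t0) ?(ltW p0)//.
      exact: ltW.
    - exact: rearrangement_nonincreasing.
  by rewrite exp2N lef_pV2 ?posrE// exp2_gt0.
apply: (@le_trans _ _ ((2 * exp2 (s / p))%:E *
  (\esum_(j in [set: int]) ((c j)%:E * lebesgue_measure (block j))))).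
  rewrite esumZl; first last.
  - by move=> j; rewrite mule_ge0// lee_fin.
  - by rewrite mulr_gt0 ?exp2_gt0.
  apply: le_esum => j _; rewrite [X in _ <= _ * (_ * X)]lebesgue_block -!EFinM lee_fin.
  rewrite /c !powRM ?exp2_ge0 ?height_ge0// -!exp2M.
  rewrite le_eqVlt; apply/orP; left; apply/eqP.
  rewrite [RHS](_ : _ = height f j `^ s * (exp2 1 * exp2 (s / p) *
     exp2 ((j%:~R - 1) / p * s) * exp2 (- j%:~R) * exp2 (j%:~R - 1)))%R; last by rewrite exp21; ring.
  by rewrite -!exp2D mulrC; congr (_ * exp2 _)%R; field; rewrite gt_eqF.
apply: lee_wpmul2l; first by rewrite lee_fin mulr_ge0 ?exp2_ge0.
rewrite -(integral_esum_indic (@lebesgue_measure R) (A := block : int -> set (measurableTypeR R)))//; last first.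
  by move=> j; exact: measurable_itv.
apply: le_integral_nonneg => [t|t].
  by apply: esum_ge0 => j _; rewrite mule_ge0// lee_fin.
have g0 : 0 <= (g \_ `]0%R, +oo[) t.
  rewrite patchE; case: ifPn => //; rewrite inE /= in_itv /= andbT => t0.
  by rewrite mule_ge0 ?poweR_ge0// lee_fin invr_ge0 ltW.
have [[j jt]|nt] := pselect (exists j, block j t); last first.
  rewrite esum1// => j _; rewrite indicE memNset ?mule0//.
  by move=> jt; apply: nt; exists j.
apply: (@le_trans _ _ (\esum_(i in [set j]) (c i)%:E)).
  rewrite [leRHS]esum_mkcond; apply: le_esum => i _; rewrite indicE.
  case: (pselect (i = j)) => [->|ij].
    by rewrite !mem_set//= mule1.
  rewrite memNset ?mule0; last by move=> it; apply: ij; exact: block_inj it jt.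
  by case: ifP => _ //; rewrite lee_fin.
rewrite esum_set1 ?lee_fin//; apply: le_trans (gc _ _ jt) _.
rewrite patchE mem_set//= in_itv /= andbT.
move: jt; rewrite /block /= in_itv /= => /andP[+ _].
by apply: lt_trans; exact: exp2_gt0.
Qed.

Lemma height_le_lorentz_oo (p : R) j : (0 < p)%R ->
  (exp2 (j%:~R / p) * height f j)%:E <= lorentz_norm p +oo f.
Proof.
move=> p0; apply: ereal_sup_ubound; exists (exp2 j%:~R); first exact: exp2_gt0.
by rewrite EFinM -heightE// exp2M.
Qed.

(** There is at least one admissible box; the supremum of an empty set would be
-oo. *)
Lemma box_average_ge0 (h : Rn R n -> R[i]) (t : 'I_n -> R) : (forall i, 0 < t i)%R ->
  0 <= box_average h t.
Proof.
move=> t0; pose Q : n.-tuple R * n.-tuple R := ([tuple 0%R | i < n], [tuple t i | i < n]).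
apply: (@le_trans _ _ ((volume Q)^-1 * Normc.normc (cintegral (box Q) h))%:E).
  rewrite lee_fin mulr_ge0 ?cabs_ge0// invr_ge0; apply: prodr_ge0 => i _.
  by rewrite /side !tnth_mktuple subr0 ltW.
apply: ereal_sup_ubound; exists Q => //; split => i; rewrite /side !tnth_mktuple//.
by rewrite subr0.
Qed.

End lorentz_sums.

(** * The estimate for one value of k, and the theorem *)

Section main_estimate.
Context {R : realType}.
Local Open Scope ereal_scope.

Lemma weighted_block_sum_le n (p r : R) : (1 <= n)%N -> (1 < p)%R -> (p < r)%R ->
  exists2 C : R, (0 < C)%R & exists2 d : R, (0 < d)%R &
  forall f : Rn R n -> R[i], L1 f -> forall k : int,
  (exp2 (k%:~R * (1 - p^-1) * r)%R)%:E *
    (\esum_(m in Dset k) (box_average (fourier f) (dyadic m)) `^ r)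
  <= C%:E * \esum_(j in [set: int])
       (exp2 (- d * `|k%:~R + j%:~R|) * (exp2 (j%:~R / p) * height f j) `^ r)%:E.
Proof.
move=> n0 p1 pr; have p0 : (0 < p)%R by apply: lt_trans p1.
have r0 : (0 < r)%R by apply: lt_trans pr.
have [C C0 [d d0 H]] := @dyadic_sum_estimate R n p^-1 r r0
  ltac:(by rewrite ltf_pV2 ?posrE) ltac:(by rewrite invf_lt1).
pose K : R := (4 * 2 ^+ n)%R; have K0 : (0 < K)%R by rewrite mulr_gt0 ?exprn_gt0.
exists (K `^ r * C)%R; first by rewrite mulr_gt0 ?powR_gt0.
exists d => // f L1f k.
pose e (j : int) (l : n.-tuple int) : R := fine (lebesgue_Rn R n (level_set f j `&` shell l)).
have mE j l : measurable (level_set f j `&` shell l).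
  by apply: measurableI; [exact: measurable_level_set|exact: measurable_shell].
have e2 j l : lebesgue_Rn R n (level_set f j `&` shell l) <=
    (exp2 (n%:R - \sum_(i < n) (tnth l i)%:~R)%R)%:E.
  rewrite -lebesgue_shell; apply: le_measure; rewrite ?inE; [exact: mE|exact: measurable_shell|].
  by move=> x [].
have eE j l : lebesgue_Rn R n (level_set f j `&` shell l) = (e j l)%:E.
  by rewrite fineK// ge0_fin_numE//; apply: le_lt_trans (e2 j l) _; exact: ltry.
have := H e (height f) _ _ _ _ k => {}H.
rewrite EFinM -muleA; apply: (@le_trans _ _ ((K `^ r)%:E * ((exp2 (k%:~R * (1 - p^-1) * r)%R)%:E *
  \esum_(m in Dset k) (\esum_(z in [set: int * n.-tuple int])
     (height f z.1 * decay m z.2 * e z.1 z.2)%:E) `^ r))); last first.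
  apply: lee_wpmul2l; first by rewrite lee_fin powR_ge0.
  apply: H.
  - by move=> j l; exact: fine_ge0.
  - exact: height_ge0.
  - by move=> j l; rewrite -lee_fin -eE.
  - move=> j; under eq_esum do rewrite -eE.
    apply: le_trans (lebesgue_level_set_le n0 L1f j).
    apply: esum_measure_le.
    + exact: measurable_level_set.
    + exact: mE.
    + by move=> l x [].
    + by move=> l l' x [_ lx] [_ lx']; exact: shell_inj lx lx'.
rewrite muleCA; apply: lee_wpmul2l; first by rewrite lee_fin exp2_ge0.
rewrite esumZl ?powR_gt0//; last by move=> m; exact: poweR_ge0.
apply: le_esum => m _; rewrite -poweR_EFin -poweRM ?lee_fin ?(ltW K0)//; last first.
  by apply: esum_ge0 => z _; rewrite lee_fin !mulr_ge0 ?height_ge0 ?decay_ge0// fine_ge0.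
apply: le_poweR; first exact: ltW.
  by apply: box_average_ge0 => i; rewrite /dyadic -exp2_int exp2_gt0.
apply: le_trans (box_average_le_shells n0 L1f m) _.
apply: lee_wpmul2l; first by rewrite lee_fin ltW.
by apply: le_esum => z _; rewrite eE -EFinM.
Qed.

End main_estimate.

Theorem theorem2p3 (R : realType) (n : nat) (p r : R) (q : \bar R)
    (hn : (1 <= n)%N) (hp : 1 < p) (hpr : p < r) (hq : (0 < q)%E) :
  let p' := p / (p - 1) in
  exists c : R, 0 < c /\
  forall f : Rn R n -> R[i], lorentz p q f -> L1 f ->
    let S (k : int) : \bar R :=
      (\esum_(m in Dset k) (box_average (fourier f) (dyadic m)) `^ r)%E in
    match q with
    | EFin s =>
        \esum_(k in [set: int]) (2 `^ (k%:~R * s / p'))%:E * (S k) `^ (s / r)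
          <= c%:E * lorentz_norm p q f `^ s
    | _ =>
        ereal_sup (range (fun k : int => (2 `^ (k%:~R / p'))%:E * (S k) `^ r^-1))
          <= c%:E * lorentz_norm p q f
    end%E.
Proof.
move=> p'.
have p0 : 0 < p by apply: lt_trans hp.
have r0 : 0 < r by apply: lt_trans hpr.
have [C C0 [d d0 H]] := @weighted_block_sum_le R n p r hn hp hpr.
have p'E : p'^-1 = 1 - p^-1.
  by rewrite /p' invf_div mulrBl mul1r mulfV ?gt_eqF.
have S0 (f : Rn R n -> R[i]) (k : int) : (0 <= \esum_(m in Dset k)
    (box_average (fourier f) (dyadic m)) `^ r)%E.
  by apply: esum_ge0 => m _; exact: poweR_ge0.
case: q hq => [s||//]; last first.
  move=> _; have [C1 C10 hC1] := @esum_geometric_int R d d0.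
  exists ((C * C1) `^ r^-1); split; first by rewrite powR_gt0// mulr_gt0.
  move=> f _ L1f; lazy zeta; apply: ge_ereal_sup => _ [k _ <-].
  have L0 : (0 <= lorentz_norm p +oo f)%E.
    apply: le_trans (height_le_lorentz_oo hn L1f 0 p0).
    by rewrite lee_fin mulr_ge0 ?exp2_ge0// height_ge0.
  rewrite (_ : 2 `^ (k%:~R / p') = (exp2 (k%:~R * (1 - p^-1) * r)) `^ r^-1); last first.
    by rewrite -exp2M mulfK ?gt_eqF// -p'E.
  rewrite -[X in (X * _ <= _)%E]poweR_EFin -[X in (_ <= X * _)%E]poweR_EFin.
  rewrite -poweRM ?lee_fin ?exp2_ge0 ?S0//.
  rewrite -[leRHS]poweRe1; last by rewrite mule_ge0// poweR_ge0.
  rewrite -[X in (_ <= _ `^ X)%E](mulfV (lt0r_neq0 r0)) poweRrM.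
  apply: le_poweR; rewrite ?invr_ge0 ?(ltW r0)//; first by rewrite mule_ge0 ?S0// lee_fin exp2_ge0.
  apply: le_trans (H f L1f k) _.
  rewrite poweRM ?poweR_ge0// poweRVK ?lee_fin ?mulr_ge0 ?(ltW C0) ?(ltW C10)//.
  rewrite EFinM -muleA; apply: lee_wpmul2l; first by rewrite lee_fin ltW.
  rewrite muleC; apply: le_trans (lee_wpmul2l (poweR_ge0 _ _) (sum_shift_le k hC1)).
  apply: le_trans (esum_leZl _ _ _); [|exact: poweR_ge0|by move=> j; rewrite lee_fin exp2_ge0].
  apply: le_esum => j _; rewrite EFinM muleC; apply: lee_wpmul2r.
    by rewrite lee_fin exp2_ge0.
  rewrite -[leLHS]poweR_EFin; apply: le_poweR; first exact: ltW.
    by rewrite lee_fin mulr_ge0 ?exp2_ge0// height_ge0.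
  exact: height_le_lorentz_oo.
rewrite lte_fin => s0.
have dd : - (d / 2) - (d / 2) = - d by field.
have th0 : 0 < s / r by rewrite divr_gt0.
have d20 : 0 < d / 2 by rewrite divr_gt0.
have d30 : 0 < d / 2 * (s / r) by rewrite mulr_gt0.
have [C1 C10 hC1] := @esum_geometric_int R _ d20.
have [C2 C20 hC2] := @esum_geometric_int R _ d30.
have p2s0 : 0 < exp2 (s / p) by exact: exp2_gt0.
exists ((C * C1) `^ (s / r) * C2 * (2 * exp2 (s / p))).
split; first by rewrite !mulr_gt0// powR_gt0// mulr_gt0.
move=> f _ L1f; lazy zeta.
pose S (k : int) : \bar R :=
  (\esum_(m in Dset k) (box_average (fourier f) (dyadic m)) `^ r)%E.
pose b (j : int) : R := exp2 (j%:~R / p) * height f j.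
have b0 j : 0 <= b j by rewrite mulr_ge0 ?exp2_ge0// height_ge0.
pose w (a : R) (k j : int) : R := exp2 (- a * `|k%:~R + j%:~R|).
have w0 a k j : 0 <= w a k j by exact: exp2_ge0.
have step k : ((2 `^ (k%:~R * s / p'))%:E * (S k) `^ (s / r) <=
    ((C * C1) `^ (s / r))%:E *
    \esum_(j in [set: int]) (w (d / 2 * (s / r)) k j * b j `^ s)%:E)%E.
  rewrite (_ : 2 `^ (k%:~R * s / p') = (exp2 (k%:~R * (1 - p^-1) * r)) `^ (s / r)); last first.
    rewrite -exp2M -p'E; congr (_ `^ _); field.
    by rewrite gt_eqF//= /p' mulf_neq0 ?invr_eq0 ?subr_eq0 ?gt_eqF.
  rewrite -[X in (X * _ <= _)%E]poweR_EFin -[X in (_ <= X * _)%E]poweR_EFin.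
  rewrite -poweRM ?lee_fin ?exp2_ge0 ?S0//.
  apply: le_trans (le_poweR (ltW th0) _ (H f L1f k)) _.
    by rewrite mule_ge0 ?S0// lee_fin exp2_ge0.
  rewrite poweRM ?lee_fin ?(ltW C0)//; last first.
    by apply: esum_ge0 => j _; rewrite lee_fin mulr_ge0 ?exp2_ge0 ?powR_ge0.
  rewrite EFinM poweRM ?lee_fin ?(ltW C0) ?(ltW C10)// -muleA.
  apply: lee_wpmul2l; first exact: poweR_ge0.
  rewrite [X in (X `^ _ <= _)%E](_ : _ = \esum_(j in [set: int])
    ((w (d / 2) k j)%:E * (w (d / 2) k j * b j `^ r)%:E))%E; last first.
    apply: eq_esum => j _; rewrite -EFinM mulrA; congr (_ * _)%:E.
    by rewrite /w -exp2D -mulrDl dd.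
  apply: le_trans (esum_wpow th0 _ _) _.
  - by move=> j; rewrite lee_fin.
  - by move=> j; rewrite lee_fin mulr_ge0 ?powR_ge0.
  rewrite [X in (_ * X <= _)%E](@eq_esum _ _ _ _
     (fun j => (w (d / 2 * (s / r)) k j * b j `^ s)%:E)); last first.
    move=> j _; rewrite poweR_EFin powRM ?powR_ge0// -powRrM.
    rewrite [r * (s / r)]mulrC divfK ?gt_eqF// /w -exp2M.
    by congr (exp2 _ * _)%:E; ring.
  apply: lee_wpmul2r.
    by apply: esum_ge0 => j _; rewrite lee_fin mulr_ge0 ?powR_ge0.
  apply: le_poweR; first exact: ltW.
    by apply: esum_ge0 => j _; rewrite lee_fin.
  exact: sum_shift_le.
apply: le_trans (le_esum (fun k _ => step k)) _.
have t0 k j : (0 <= (w (d / 2 * (s / r)) k j * b j `^ s)%:E)%E.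
  by rewrite lee_fin mulr_ge0 ?powR_ge0.
apply: le_trans (esum_leZl _ _ _) _; [by rewrite lee_fin powR_ge0|by move=> k; exact: esum_ge0|].
rewrite 2!EFinM -!muleA; apply: lee_wpmul2l; first by rewrite lee_fin powR_ge0.
rewrite esum_exchange//.
apply: (@le_trans _ _ (C2%:E * \esum_(j in [set: int]) (b j `^ s)%:E)%E); last first.
  apply: lee_wpmul2l; first by rewrite lee_fin ltW.
  exact: esum_height_le.
rewrite esumZl//; last by move=> j; rewrite lee_fin powR_ge0.
apply: le_esum => j _; under eq_esum do rewrite mulrC EFinM.
apply: le_trans (esum_leZl _ _ _) _; [by rewrite lee_fin powR_ge0|by move=> k; rewrite lee_fin|].
rewrite muleC; apply: lee_wpmul2r; first by rewrite lee_fin powR_ge0.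
apply: le_trans (sum_shift_le j hC2); apply: le_esum => k _.
by rewrite /w addrC.
Qed.
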